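(* Let $G=(V,E)$ be a connected, locally finite graph with vertex weight $\mu:V\to(0,\infty)$, $\mu(x)\ge\mu_{\min}>0$ for all $x\in V$, and let $p>4$. Let $a,b:V\to[0,\infty)$, $\Omega_a=\{x\in V:a(x)=0\}$, $\Omega_b=\{x\in V:b(x)=0\}$, and assume that $\Omega_a$, $\Omega_b$ and $\Omega_a\cap\Omega_b$ are nonempty bounded domains in $V$ and that (A2'') there exists $\mathcal M_0>0$ such that $\frac1a\in L^1\big(V\setminus(D^a_{\mathcal M_0}\cup\Omega_a)\big)$ and $\frac1b\in L^1\big(V\setminus(D^b_{\mathcal M_0}\cup\Omega_b)\big)$, where $D^a_{\mathcal M_0}=\{a\le\mathcal M_0\}$, $D^b_{\mathcal M_0}=\{b\le\mathcal M_0\}$ have finite volume. Assume in addition that there are constants $a_0,b_0>0$ with $a\ge a_0$ on $\Omega_a^c=V\setminus\Omega_a$ and $b\ge b_0$ on $\Omega_b^c=V\setminus\Omega_b$. For $\Lambda>0$ let $(u_\Lambda,v_\Lambda)$ be a ground state of the penalised functional $J_\Lambda$ with potentials $a_\Lambda=1+\Lambda a$, $b_\Lambda=1+\Lambda b$. Then there exists a constant $C>0$, depending only on $p,a_0,b_0$ and the graph geometry, such that for all sufficiently large $\Lambda$, $$\int_{\Omega_a^c}|u_\Lambda|^p\,d\mu\le C\Lambda^{-1},\qquad\int_{\Omega_b^c}|v_\Lambda|^p\,d\mu\le C\Lambda^{-1}.$$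
   Context: Notation. $x\sim y$ means $(x,y)\in E$; $\int_V f\,d\mu=\sum_{x\in V}f(x)\mu(x)$; bounded means of finite diameter for the graph distance. $|\nabla u|(x)=\big(\frac1{2\mu(x)}\sum_{y\sim x}(u(y)-u(x))^2\big)^{1/2}$. $W^{1,p}(V)$ is the completion of the finitely supported functions under $(\int_V(|\nabla u|^p+|u|^p)d\mu)^{1/p}$. Expressions such as $s^2\log s^2$ are $0$ at $s=0$. $\mathcal H_{\Lambda,a}=\{u\in W^{1,p}(V):\int_V(1+\Lambda a)|u|^pd\mu<\infty\}$ with $\|u\|_{\mathcal H_{\Lambda,a}}=(\int_V(|\nabla u|^p+(1+\Lambda a)|u|^p)d\mu)^{1/p}$, $\mathcal H_{\Lambda,b}$ likewise with $b$, $\mathcal H_\Lambda=\mathcal H_{\Lambda,a}\times\mathcal H_{\Lambda,b}$. The penalised functional is $$J_\Lambda(u,v)=\tfrac1p\big(\|u\|^p_{\mathcal H_{\Lambda,a}}+\|v\|^p_{\mathcal H_{\Lambda,b}}\big)-\tfrac1p\int_V\big(|u|^{p-2}v^2\log v^2+|v|^{p-2}u^2\log u^2\big)d\mu,$$ $\mathcal N_\Lambda=\{(u,v)\in\mathcal H_\Lambda\setminus\{(0,0)\}:J_\Lambda'(u,v)\cdot(u,v)=0\}$, $d_\Lambda=\inf_{\mathcal N_\Lambda}J_\Lambda$; a ground state of $J_\Lambda$ is $(u,v)\in\mathcal N_\Lambda$ with $J_\Lambda(u,v)=d_\Lambda$ (ground states exist for $\Lambda$ sufficiently large). *)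

(* Defs.v *)
From mathcomp Require Import all_boot all_order all_algebra.
From mathcomp Require Import all_classical all_reals all_analysis.
Import Order.TTheory GRing.Theory Num.Theory.
Import numFieldNormedType.Exports.

Set Implicit Arguments.
Unset Strict Implicit.
Unset Printing Implicit Defensive.

Local Open Scope classical_set_scope.
Local Open Scope ring_scope.

Section Graph.
Variables (V : choiceType) (E : rel V).

Definition locally_finite := forall x : V, finite_set [set y | E x y].

Definition connected_in (A : set V) := forall x y, A x -> A y ->
  exists s : seq V,
    [/\ path E x s, last x s = y & forall z, z \in s -> A z].

(* the distance is the least length of a path, in the whole graph *)
Definition dist_le (x y : V) (n : nat) := exists s : seq V,
  [/\ path E x s, last x s = y & (size s <= n)%N].

Definition finite_diameter (A : set V) :=
  exists n : nat, forall x y, A x -> A y -> dist_le x y n.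

Definition bounded_domain (A : set V) := finite_diameter A /\ connected_in A.

(* A loop at x contributes 0 to the gradient and is irrelevant to distances
   and connectedness, so irreflexivity of E need not be imposed. *)
Definition connected_locally_finite_graph :=
  [/\ symmetric E, locally_finite & connected_in setT].

End Graph.

Section Integral.
Variables (R : realType) (V : choiceType) (mu : V -> R).

(* Unconditional sum over A of f(x) mu(x): the sum of the positive parts minus
   that of the negative parts; for f >= 0 the second sum is 0. *)
Definition gint (A : set V) (f : V -> R) : \bar R :=
  let g x := (f x * mu x)%:E in
  (\esum_(x in A) g^\+ x - \esum_(x in A) g^\- x)%E.

Definition L1 (A : set V) (f : V -> R) : Prop :=
  summable A (fun x => (f x * mu x)%:E).

Definition volume (A : set V) : \bar R := \esum_(x in A) (mu x)%:E.

End Integral.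

Section Functionals.
Variables (R : realType) (V : choiceType) (E : rel V) (mu : V -> R) (p : R).

Definition gradn (u : V -> R) (x : V) : R :=
  Num.sqrt ((2 * mu x)^-1 * \sum_(y \in [set y | E x y]) (u y - u x) ^+ 2).

Definition finitely_supported (u : V -> R) := finite_set [set x | u x != 0].

Definition W1p_norm (u : V -> R) : \bar R :=
  poweR (gint mu setT (fun x => gradn u x `^ p + `|u x| `^ p)) p^-1.

(* The completion, realised inside the functions on V: since mu > 0,
   convergence in W1p_norm implies pointwise convergence, so a Cauchy class of
   finitely supported functions is represented by its pointwise limit, which
   is also its limit in W1p_norm. *)
Definition W1p (u : V -> R) := exists phi : nat -> V -> R,
  (forall n, finitely_supported (phi n)) /\
  W1p_norm (u - phi n) @[n --> \oo] --> 0%E.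

Definition potential (Lam : R) (a : V -> R) (x : V) : R := 1 + Lam * a x.

Definition Hspace (Lam : R) (a : V -> R) : set (V -> R) :=
  [set u | W1p u /\
     (gint mu setT (fun x => (potential Lam a x * `|u x| `^ p)%R) < +oo)%E].

(* finite on Hspace, so that fine is harmless there *)
Definition Hnorm (Lam : R) (a u : V -> R) : R :=
  fine (poweR (gint mu setT (fun x =>
    gradn u x `^ p + potential Lam a x * `|u x| `^ p)) p^-1).

(* ln 0 = 0, so s ^+ 2 * ln (s ^+ 2) vanishes at s = 0 *)
Definition log_term (u v : V -> R) (x : V) : R :=
  `|u x| `^ (p - 2) * (v x ^+ 2 * ln (v x ^+ 2)) +
  `|v x| `^ (p - 2) * (u x ^+ 2 * ln (u x ^+ 2)).

(* For p > 4 and u, v in the spaces Hspace of a and b, log_term u v is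
   summable against mu under the assumption A2'' below, so that fine is
   harmless. *)
Definition J (a b : V -> R) (Lam : R) (w : (V -> R) * (V -> R)) : R :=
  p^-1 * (Hnorm Lam a w.1 `^ p + Hnorm Lam b w.2 `^ p)
  - p^-1 * fine (gint mu setT (log_term w.1 w.2)).

(* J'(w) . h = l, as a directional derivative *)
Definition deriv_along (F : (V -> R) * (V -> R) -> R)
    (w h : (V -> R) * (V -> R)) (l : R) : Prop :=
  is_derive (0 : R) (1 : R) (fun t : R => F (w + t *: h)) l.

Definition Nehari (a b : V -> R) (Lam : R) : set ((V -> R) * (V -> R)) :=
  [set w | [/\ Hspace Lam a w.1, Hspace Lam b w.2, w <> 0 &
               deriv_along (J a b Lam) w w 0]].

Definition dinf (a b : V -> R) (Lam : R) : \bar R :=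
  ereal_inf [set (J a b Lam w)%:E | w in Nehari a b Lam].

Definition ground_state (a b : V -> R) (Lam : R)
    (w : (V -> R) * (V -> R)) : Prop :=
  Nehari a b Lam w /\ (J a b Lam w)%:E = dinf a b Lam.

End Functionals.

Section Potentials.
Variables (R : realType) (V : choiceType) (mu : V -> R).

Definition zeros (a : V -> R) : set V := [set x | a x = 0].

Definition sublevel (a : V -> R) (M : R) : set V := [set x | a x <= M].

Definition A2'' (a b : V -> R) : Prop := exists M0 : R,
  [/\ 0 < M0,
      (volume mu (sublevel a M0) < +oo)%E,
      (volume mu (sublevel b M0) < +oo)%E,
      L1 mu (~` (sublevel a M0 `|` zeros a)) (fun x => (a x)^-1) &
      L1 mu (~` (sublevel b M0 `|` zeros b)) (fun x => (b x)^-1)].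

End Potentials.

(* Main.v *)
(* Write N for the energy ||u||^p + ||v||^p, K for the integral of
   |u|^(p-2) v^2 + |v|^(p-2) u^2 and I for the logarithmic integral.  Along a ray
   J(s w) = s^p (N - I - 2 K ln s) / p, so that on the Nehari manifold
   N - I = 2 K / p and J = 2 K / p^2.

   Testing with (delta, delta) at a point of both zero sets bounds K, hence
   (since mu >= mumin controls the sup norms, and thus the logarithms) N, by a
   constant C1 independent of Lambda; also K is bounded below.  Hence u is at
   most e = O(Lambda^(-1/p)) off the zeros of a, and v off those of b.  Compare
   the ground state with its soft thresholding at height e: this is a
   contraction, so the gradients do not increase, and it is supported in the
   zero sets, so all the potential energy disappears.  As x ln x - y ln y is at
   most (L + 1)(x - y) for y <= x with ln x <= L, minimality gives
   N - N' <= (L + 2)(K - K'), and K - K' = O(e) because (A2'') bounds u and v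
   in L^(p-1).  So Lambda times the potential energy tends to 0, and is at most 1
   from some Lambda0 on; only Lambda0, and not C, depends on a and b. *)
Require Import Defs.
From mathcomp Require Import finmap.
From mathcomp Require Import all_boot all_order all_algebra.
From mathcomp Require Import all_classical all_reals all_analysis.
From mathcomp Require Import ring lra.
Import Order.TTheory GRing.Theory Num.Theory.
Import numFieldNormedType.Exports.

Set Implicit Arguments.
Unset Strict Implicit.
Unset Printing Implicit Defensive.

Local Open Scope classical_set_scope.
Local Open Scope ring_scope.

(** * Unconditional weighted sums with real values *)

Section WeightedSums.
Variables (R : realType) (V : choiceType) (mu : V -> R).
Hypothesis mu_gt0 : forall x, 0 < mu x.
Implicit Types (f g h : V -> R) (c : R).

Let L1 := L1 mu setT.

(** Infinite sums are sent to 0 by [fine], so linearity and monotonicity are available only on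
    [L1]. *)
Definition rsum f : R := fine (gint mu setT f).

Let T f : \bar R := \esum_(x in setT) (f x * mu x)%:E.

Lemma L1_le f g : (forall x, `|f x| <= g x) -> L1 g -> L1 f.
Proof.
move=> fg; apply: le_lt_trans; apply: le_esum => x _.
rewrite !abse_EFin lee_fin !normrM ler_wpM2r//.
by rewrite (le_trans (fg x))// ler_norm.
Qed.

Lemma L1D f g : L1 f -> L1 g -> L1 (fun x => f x + g x).
Proof.
move=> L1f L1g; rewrite /L1 /Defs.L1.
under eq_fun do rewrite mulrDl EFinD.
exact: summableD.
Qed.

Lemma L1N f : L1 f -> L1 (fun x => - f x).
Proof.
move=> L1f; apply: le_lt_trans L1f; apply: le_esum => x _.
by rewrite mulNr EFinN abseN.
Qed.

Lemma L1B f g : L1 f -> L1 g -> L1 (fun x => f x - g x).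
Proof. by move=> L1f L1g; apply: L1D => //; exact: L1N. Qed.

Lemma L1_norm f : L1 f -> L1 (fun x => `|f x|).
Proof.
apply: le_lt_trans; apply: le_esum => x _.
by rewrite !abse_EFin !normrM normr_id.
Qed.

Lemma T_ge0_fin f : (forall x, 0 <= f x) -> L1 f -> T f \is a fin_num.
Proof.
move=> f0; rewrite /L1 /Defs.L1 summableE => L1f.
rewrite (_ : T f = \esum_(x in setT) `|(f x * mu x)%:E|%E)//.
by apply: eq_esum => x _; rewrite gee0_abs// lee_fin mulr_ge0// ltW.
Qed.

Lemma gint_ge0 A f : (forall x, 0 <= f x) ->
  gint mu A f = \esum_(x in A) (f x * mu x)%:E.
Proof.
move=> f0; have fmu0 x : (0 <= (f x * mu x)%:E)%E.
  by rewrite lee_fin mulr_ge0// ltW.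
rewrite /gint (esum1 (a := fun x => _^\- x)%E) ?sube0; last first.
  by move=> x _; rewrite (ge0_funenegE (D := setT)) ?inE.
by apply: eq_esum => x _; rewrite (ge0_funeposE (D := setT)) ?inE.
Qed.

Lemma gint_rsum f : (forall x, 0 <= f x) -> L1 f ->
  gint mu setT f = (rsum f)%:E.
Proof. by move=> f0 ?; rewrite /rsum gint_ge0// fineK// T_ge0_fin. Qed.

Lemma L1_gint f : (forall x, 0 <= f x) -> (gint mu setT f < +oo)%E -> L1 f.
Proof.
move=> f0; rewrite gint_ge0//; apply: le_lt_trans; apply: le_esum => x _.
by rewrite gee0_abs// lee_fin mulr_ge0// ltW.
Qed.

(** Any decomposition into non-negative summable functions computes the sum, not only the one into
    positive and negative parts; additivity for signed functions thus reduces to [TD]. *)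
Let rsumE f g h : (forall x, f x = g x - h x) ->
  (forall x, 0 <= g x) -> (forall x, 0 <= h x) -> L1 g -> L1 h ->
  rsum f = fine (T g) - fine (T h).
Proof.
move=> fgh g0 h0 L1g L1h; rewrite -fineB ?T_ge0_fin//; congr fine.
rewrite -esumB//; last 2 first.
- by move=> x _; rewrite lee_fin mulr_ge0// ltW.
- by move=> x _; rewrite lee_fin mulr_ge0// ltW.
rewrite /gint/=; suff -> : (fun x => (f x * mu x)%:E) =
  ((fun x => (g x * mu x)%:E) \- (fun x => (h x * mu x)%:E))%E by [].
by apply/funext => x; rewrite fgh mulrBl EFinB.
Qed.

Let TD f g : (forall x, 0 <= f x) -> (forall x, 0 <= g x) -> L1 f -> L1 g ->
  fine (T (fun x => f x + g x)) = fine (T f) + fine (T g).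
Proof.
move=> f0 g0 L1f L1g; rewrite -fineD ?T_ge0_fin//; congr fine.
rewrite /T -esumD; last 2 first.
- by move=> x _; rewrite lee_fin mulr_ge0// ltW.
- by move=> x _; rewrite lee_fin mulr_ge0// ltW.
by apply: eq_esum => x _; rewrite mulrDl EFinD.
Qed.

Lemma rsumD f g : L1 f -> L1 g ->
  rsum (fun x => f x + g x) = rsum f + rsum g.
Proof.
move=> L1f L1g; have abs0 (k : V -> R) x : 0 <= k x + `|k x|.
  by rewrite -lerBlDl sub0r -normrN ler_norm.
(* The split [k = (k + |k|) - |k|] has non-negative parts, and the splits of f and g add up to a
   split of [f + g]. *)
have rsumA k : L1 k -> rsum k =
    fine (T (fun x => k x + `|k x|)) - fine (T (fun x => `|k x|)).
  move=> L1k; apply: rsumE => //; [by move=> x; rewrite addrK| |].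
    by apply: L1D => //; exact: L1_norm.
  exact: L1_norm.
rewrite (rsumA _ L1f) (rsumA _ L1g).
rewrite (@rsumE _ (fun x => (f x + `|f x|) + (g x + `|g x|))
  (fun x => `|f x| + `|g x|)); last 5 first.
- by move=> x; ring.
- by move=> x; rewrite addr_ge0.
- by move=> x; rewrite addr_ge0.
- by apply: L1D; apply: L1D => //; exact: L1_norm.
- by apply: L1D; exact: L1_norm.
have L1a k : L1 k -> L1 (fun x => k x + `|k x|).
  by move=> L1k; apply: L1D => //; exact: L1_norm.
have -> := @TD (fun x => f x + `|f x|) (fun x => g x + `|g x|)
  (abs0 f) (abs0 g) (L1a _ L1f) (L1a _ L1g).
have -> := @TD (fun x => `|f x|) (fun x => `|g x|)
  (fun=> normr_ge0 _) (fun=> normr_ge0 _) (L1_norm L1f) (L1_norm L1g).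
by ring.
Qed.

Lemma rsum_ge0 f : (forall x, 0 <= f x) -> 0 <= rsum f.
Proof.
move=> f0; rewrite /rsum gint_ge0// fine_ge0// esum_ge0// => x _.
by rewrite lee_fin mulr_ge0// ltW.
Qed.

Lemma rsumB f g : L1 f -> L1 g ->
  rsum (fun x => f x - g x) = rsum f - rsum g.
Proof.
move=> L1f L1g; apply/eqP; rewrite -subr_eq opprK; apply/eqP.
by rewrite -rsumD//; [congr rsum; apply/funext => x; rewrite subrK|exact: L1B].
Qed.

Lemma le_rsum f g : L1 f -> L1 g -> (forall x, f x <= g x) ->
  rsum f <= rsum g.
Proof.
move=> L1f L1g fg; rewrite -subr_ge0 -rsumB// rsum_ge0// => x.
by rewrite subr_ge0.
Qed.

Lemma L1Z c f : L1 f -> L1 (fun x => c * f x).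
Proof.
move=> L1f; rewrite /L1 /Defs.L1 /summable.
have : (`|c%:E| * (\esum_(x in setT) `|(f x * mu x)%:E|) < +oo)%E.
  move: L1f; rewrite /L1 /Defs.L1 summableE => /fineK <-.
  by rewrite abse_EFin -EFinM ltry.
apply: le_lt_trans; apply: ge_ereal_sup => _ [X [finX _] <-].
under eq_fsbigr do rewrite -mulrA EFinM abseM.
rewrite -ge0_mule_fsumr// lee_wpmul2l// ?lee_fin//.
by apply: esum_ge; exists X.
Qed.

Lemma rsumZ_le c f : 0 <= c -> (forall x, 0 <= f x) -> L1 f ->
  rsum (fun x => c * f x) <= c * rsum f.
Proof.
move=> c0 f0 L1f; have cf0 x : 0 <= c * f x by rewrite mulr_ge0.
rewrite -lee_fin EFinM -!gint_rsum ?gint_ge0//; last exact: L1Z.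
apply: ge_ereal_sup => _ [X [finX _] <-].
under eq_fsbigr do rewrite -mulrA EFinM.
rewrite -ge0_mule_fsumr//; last first.
  by move=> x; rewrite lee_fin mulr_ge0// ltW.
rewrite lee_wpmul2l ?lee_fin//.
by apply: esum_ge; exists X.
Qed.

(** The converse of [rsumZ_le] is [rsumZ_le] itself, for the factor [c^-1] and the function
    [c f]. *)
Let rsumZ_ge0 c f : 0 < c -> (forall x, 0 <= f x) -> L1 f ->
  rsum (fun x => c * f x) = c * rsum f.
Proof.
move=> c0 f0 L1f; apply/eqP; rewrite eq_le; apply/andP; split.
  by apply: rsumZ_le => //; exact: ltW.
rewrite -ler_pdivlMl//.
have {1}-> : f = fun x => c^-1 * (c * f x).
  by apply/funext => x; rewrite mulKf// gt_eqF.
apply: rsumZ_le; rewrite ?invr_ge0 ?ltW//; last exact: L1Z.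
by move=> x; rewrite mulr_ge0// ltW.
Qed.

Let rsumZ_gt0 c f : 0 < c -> L1 f -> rsum (fun x => c * f x) = c * rsum f.
Proof.
move=> c0 L1f; have L1a := L1_norm L1f; have L1s := L1D L1f L1a.
have -> : rsum f = rsum (fun x => f x + `|f x|) - rsum (fun x => `|f x|).
  by rewrite rsumD// addrK.
rewrite mulrBr -[c * _]rsumZ_ge0//; last first.
  by move=> x; rewrite -lerBlDl sub0r -normrN ler_norm.
rewrite -[c * rsum (fun x => `|f x|)]rsumZ_ge0// -rsumB; try exact: L1Z.
by congr rsum; apply/funext => x; ring.
Qed.

Lemma rsumZ c f : L1 f -> rsum (fun x => c * f x) = c * rsum f.
Proof.
move=> L1f; have c1 : 0 < `|c| + 1 by rewrite ltr_wpDl.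
have c2 : 0 < c + (`|c| + 1).
  by rewrite addrA ltr_wpDl// -lerBlDl sub0r -normrN ler_norm.
(* A scalar of arbitrary sign is the difference of two positive ones, [c + |c| + 1] and
   [|c| + 1]. *)
have -> : (fun x => c * f x) =
    fun x => (c + (`|c| + 1)) * f x - (`|c| + 1) * f x.
  by apply/funext => x; ring.
rewrite rsumB; try exact: L1Z.
rewrite [rsum (fun x => _)](_ : _ = (c + (`|c| + 1)) * rsum f); last exact: rsumZ_gt0.
by rewrite rsumZ_gt0//; ring.
Qed.

Lemma rsum0 : rsum (fun=> 0) = 0.
Proof. by rewrite /rsum gint_ge0// esum1// => x _; rewrite mul0r. Qed.

(** A singleton is one of the finite sets in the supremum. Combined with [mu >= mumin], this turns
    integral bounds into pointwise ones. *)
Lemma rsum_ge_pt f x : (forall x, 0 <= f x) -> L1 f -> f x * mu x <= rsum f.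
Proof.
move=> f0 L1f; rewrite -lee_fin -gint_rsum// gint_ge0//.
apply: esum_ge; exists [set x]; first by split.
by rewrite fsbig_set1.
Qed.

Lemma rsum_le_subset (A : set V) f g : (forall x, 0 <= f x) ->
  (forall x, 0 <= g x) -> L1 g -> (forall x, A x -> f x <= g x) ->
  (gint mu A f <= (rsum g)%:E)%E.
Proof.
move=> f0 g0 L1g fg; rewrite -gint_rsum// !gint_ge0// esum_mkcond.
apply: le_esum => x _; case: ifPn => [|_].
  by rewrite inE => Ax; rewrite lee_fin ler_wpM2r ?fg// ltW.
by rewrite lee_fin mulr_ge0// ltW.
Qed.

Lemma L1_finite_support f : finite_set [set x | f x != 0] -> L1 f.
Proof.
move=> finf; rewrite /L1 /Defs.L1 /summable.
rewrite (_ : esum _ _ = \esum_(x in [set x | f x != 0]) `|(f x * mu x)%:E|%E).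
  rewrite esum_fset// fsbig_finite//= sumEFin ltry//.
rewrite [RHS]esum_mkcond; apply: eq_esum => x _; case: ifPn => //.
by rewrite notin_setE/= => /negP; rewrite negbK => /eqP ->; rewrite mul0r normr0.
Qed.

Lemma rsum_gt0 f x : (forall x, 0 <= f x) -> L1 f -> 0 < f x -> 0 < rsum f.
Proof.
move=> f0 L1f fx; apply: lt_le_trans (rsum_ge_pt x f0 L1f).
by rewrite mulr_gt0.
Qed.

End WeightedSums.

(** * Pointwise inequalities for powers, logarithms and thresholding *)

Section PointwiseInequalities.
Variable R : realType.
Implicit Types x y s t e p q M L A X : R.

(** The larger of x and y dominates both factors: a Young inequality without conjugate exponents. *)
Lemma powR_mulXn_le x y q n : 0 <= x -> 0 <= y -> 0 < q ->
  x `^ q * y ^+ n <= x `^ (q + n%:R) + y `^ (q + n%:R).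
Proof.
move=> x0 y0 q0; have qn0 : q + n%:R != 0 by rewrite gt_eqF// ltr_wpDr.
have [xy|/ltW yx] := leP x y.
- apply: (@le_trans _ _ (y `^ (q + n%:R))); last by rewrite lerDr powR_ge0.
  rewrite powRD ?(negbTE qn0)// powR_mulrn// ler_wpM2r ?exprn_ge0//.
  by rewrite ge0_ler_powR// ltW.
- apply: (@le_trans _ _ (x `^ (q + n%:R))); last by rewrite lerDl powR_ge0.
  rewrite powRD ?(negbTE qn0)// powR_mulrn// ler_wpM2l ?powR_ge0//.
  by rewrite lerXn2r.
Qed.

(** A mean value inequality with a spare factor 2. In terms of [r = t / s] it is immediate for
    [r <= 1/2]; otherwise [r^q >= 1 + q ln r] and [- ln r <= r^-1 - 1 <= 2 (1 - r)]. *)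
Lemma powR_sub_le s t q : 1 <= q -> 0 <= t -> t <= s ->
  s `^ q - t `^ q <= 2 * q * s `^ (q - 1) * (s - t).
Proof.
move=> q1 t0 ts; have q0 : 0 < q by exact: lt_le_trans q1.
have [s0|s0] := leP s 0.
  have -> : s = t by apply/eqP; rewrite eq_le ts (le_trans s0 t0).
  by rewrite !subrr mulr0.
set r := t / s; have r0 : 0 <= r by rewrite divr_ge0// ltW.
have tE : t = s * r by rewrite /r mulrC divfK// gt_eqF.
have r1 : r <= 1 by rewrite ler_pdivrMr// mul1r.
move: r0 r1 tE; move: r => r r0 r1 tE.
have -> : 2 * q * s `^ (q - 1) * (s - t) = s `^ q * (2 * q * (1 - r)).
  by rewrite tE -(mulr_powRB1 (ltW s0) q0); ring.
rewrite {1}tE powRM ?(ltW s0)// -{1}[s `^ q]mulr1 -mulrBr ler_wpM2l ?powR_ge0//.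
have [r2|r2] := leP r (2^-1).
  apply: (@le_trans _ _ 1); first by rewrite lerBlDr lerDl powR_ge0.
  have r12 : 0 <= 1 - 2 * r by lra.
  by have := mulr_ge0 (ltW q0) r12; nra.
have rp : 0 < r by apply: lt_trans r2; rewrite invr_gt0.
have lr : - ln r <= 2 * (1 - r).
  rewrite -lnV//; have := @le_ln1Dx R (r^-1 - 1).
  rewrite [1 + _]addrC subrK => /(_ _)/le_trans-> //.
    by rewrite ltrBrDr addNr invr_gt0.
  have -> : r^-1 - 1 = r^-1 * (1 - r) by rewrite mulrBr mulr1 mulVf// gt_eqF.
  rewrite ler_wpM2r ?subr_ge0//.
  by rewrite -[leRHS]invrK lef_pV2 ?posrE// ?invr_gt0// ltW.
rewrite /powR gt_eqF//; have := expR_ge1Dx (q * ln r).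
by nra.
Qed.

Lemma xlnx_sub_le x y L : 0 <= y -> y <= x -> 0 <= L -> ln x <= L ->
  x * ln x - y * ln y <= (L + 1) * (x - y).
Proof.
move=> y0 yx L0 lxL; move: y0 yx; rewrite le_eqVlt => /orP[/eqP <- x0|y0 yx].
  by rewrite mul0r !subr0 mulrC ler_wpM2r//; lra.
have x0 : 0 < x by exact: lt_le_trans yx.
(* Times y, this bounds the second term of [x ln x - y ln y = (x - y) ln x + y (ln x - ln y)] by
   [x - y]; the first is at most [L (x - y)]. *)
have : ln x - ln y <= x / y - 1.
  rewrite -ln_div// -[in leLHS](subrK 1 (x / y)) addrC le_ln1Dx//.
  by rewrite ltrBrDr addNr divr_gt0.
rewrite -(ler_pM2l y0) [leRHS]mulrBr mulrCA divff ?gt_eqF// => H.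
by nra.
Qed.

Lemma mul_xlnx_sub_le A A' x y L : 0 <= A' -> A' <= A ->
  0 <= y -> y <= x -> 0 <= L -> ln x <= L ->
  A * (x * ln x) - A' * (y * ln y) <= (L + 1) * (A * x - A' * y).
Proof.
move=> A0 AA y0 yx L0 lxL; have := xlnx_sub_le y0 yx L0 lxL => H.
(* One factor varies at a time: [x ln x <= (L + 1) x] handles the first term, [xlnx_sub_le] the
   second. *)
have -> : A * (x * ln x) - A' * (y * ln y) =
  (A - A') * (x * ln x) + A' * (x * ln x - y * ln y) by ring.
have -> : (L + 1) * (A * x - A' * y) =
  (A - A') * ((L + 1) * x) + A' * ((L + 1) * (x - y)) by ring.
rewrite lerD// ler_wpM2l ?subr_ge0// mulrC ler_wpM2r ?(le_trans y0 yx)//.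
by rewrite (le_trans lxL)// lerDl.
Qed.

(** [ln s < s] bounds the positive part and [ln s^-1 < s^-1] the negative one. Being linear in s,
    the bound combines with a power [p - 2] into powers [p - 1], which (A2'') and finite energy make
    summable. *)
Lemma sqr_ln_sqr_le s M : 0 <= s -> s <= M ->
  `|s ^+ 2 * ln (s ^+ 2)| <= 2 * (M ^+ 2 + 1) * s.
Proof.
rewrite le_eqVlt => /orP[/eqP <- _|s0 sM].
  by rewrite expr0n/= mul0r normr0 mulr0.
have := ln_sublinear s0.
have : ln s^-1 < s^-1 by rewrite ln_sublinear// invr_gt0.
rewrite lnV ?posrE// lnXn// -mulr_natl => h1 h2.
have h3 : s * s^-1 = 1 by rewrite divff// gt_eqF.
have h4 : s ^+ 2 <= M ^+ 2 by rewrite lerXn2r// nnegrE ltW// (lt_le_trans s0).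
have h5 : - (s ^+ 2 * ln s) <= s.
  rewrite -mulrN expr2 -mulrA -[leRHS]mulr1 -h3 ler_wpM2l ?(ltW s0)//.
  by rewrite ler_wpM2l ?(ltW s0)// ltW.
have h6 : s ^+ 2 * ln s <= M ^+ 2 * s.
  apply: (@le_trans _ _ (s ^+ 2 * s)).
    by rewrite ler_wpM2l ?sqr_ge0// ltW.
  by rewrite ler_wpM2r// ltW.
have h7 : 0 <= M ^+ 2 * s by rewrite mulr_ge0 ?sqr_ge0// ltW.
rewrite ler_norml; apply/andP; split; nra.
Qed.

(** Changing one factor at a time gains e and loses one degree. The two changes contribute the
    constants [2 (p - 2)] and 2, together below [2 p]. *)
Lemma powR_sqr_sub_le s s' t t' e p : 4 < p ->
  0 <= s' -> s' <= s -> s - s' <= e -> 0 <= t' -> t' <= t -> t - t' <= e ->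
  s `^ (p - 2) * t ^+ 2 - s' `^ (p - 2) * t' ^+ 2 <=
  2 * p * e * (s `^ (p - 1) + t `^ (p - 1)).
Proof.
move=> p4 s0 ss se t0 tt te.
have s1 : 0 <= s by lra. have t1 : 0 <= t by lra. have e0 : 0 <= e by lra.
set S := _ `^ (p - 1) + _; have S0 : 0 <= S by rewrite addr_ge0 ?powR_ge0.
have h1 : s `^ (p - 3) * t ^+ 2 <= S.
  have -> : S = s `^ (p - 3 + 2%:R) + t `^ (p - 3 + 2%:R).
    by rewrite (_ : p - 3 + 2%:R = p - 1)//; ring.
  by apply: powR_mulXn_le => //; lra.
have h2 : s `^ (p - 2) * t <= S.
  have -> : S = s `^ (p - 2 + 1%:R) + t `^ (p - 2 + 1%:R).
    by rewrite (_ : p - 2 + 1%:R = p - 1)//; ring.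
  by rewrite -[leLHS]/(_ * t ^+ 1); apply: powR_mulXn_le => //; lra.
have h3 : s `^ (p - 2) - s' `^ (p - 2) <= 2 * (p - 2) * s `^ (p - 3) * e.
  have p21 : 1 <= p - 2 by lra.
  have := powR_sub_le p21 s0 ss.
  rewrite (_ : p - 2 - 1 = p - 3); last by ring.
  move/le_trans; apply; rewrite ler_wpM2l// mulr_ge0 ?powR_ge0//; lra.
have h4 : s' `^ (p - 2) <= s `^ (p - 2).
  by rewrite ge0_ler_powR ?nnegrE//; lra.
have -> : s `^ (p - 2) * t ^+ 2 - s' `^ (p - 2) * t' ^+ 2 =
  (s `^ (p - 2) - s' `^ (p - 2)) * t ^+ 2 + s' `^ (p - 2) * (t ^+ 2 - t' ^+ 2).
  by ring.
have h5 : (s `^ (p - 2) - s' `^ (p - 2)) * t ^+ 2 <= 2 * (p - 2) * e * S.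
  apply: (@le_trans _ _ (2 * (p - 2) * s `^ (p - 3) * e * t ^+ 2)).
    by rewrite ler_wpM2r// sqr_ge0.
  have -> : 2 * (p - 2) * s `^ (p - 3) * e * t ^+ 2 =
    2 * (p - 2) * e * (s `^ (p - 3) * t ^+ 2) by ring.
  by rewrite ler_wpM2l// mulr_ge0// mulr_ge0//; lra.
have h6 : s' `^ (p - 2) * (t ^+ 2 - t' ^+ 2) <= 2 * e * S.
  apply: (@le_trans _ _ (s `^ (p - 2) * (2 * e * t))).
    apply: ler_pM => //; [exact: powR_ge0|by nra|by nra].
  have -> : s `^ (p - 2) * (2 * e * t) = 2 * e * (s `^ (p - 2) * t) by ring.
  by rewrite ler_wpM2l// mulr_ge0.
have h7 : 0 <= e * S by rewrite mulr_ge0.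
nra.
Qed.

(** For [e >= 0] this is [sign(x) max(|x| - e, 0)]; the piecewise linear form leaves only case
    distinctions and linear arithmetic. *)
Definition soft_threshold e x : R := Num.max (x - e) (Num.min (x + e) 0).

Lemma soft_threshold_lipschitz e x y : 0 <= e ->
  `|soft_threshold e x - soft_threshold e y| <= `|x - y|.
Proof.
move=> e0; rewrite /soft_threshold !maxEle !minEle.
have := ler_norm (x - y); have := ler_norm (y - x); rewrite (distrC y) => h1 h2.
by rewrite ler_norml; do ! case: ifPn; rewrite -?ltNge => *; apply/andP; split; lra.
Qed.

Lemma soft_threshold0 e x : `|x| <= e -> soft_threshold e x = 0.
Proof.
rewrite ler_norml /soft_threshold => /andP[h1 h2].
by rewrite min_r ?max_r//; lra.
Qed.

Lemma soft_threshold_le e x : 0 <= e -> `|soft_threshold e x| <= `|x|.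
Proof.
move=> e0; have := soft_threshold_lipschitz x 0 e0.
by rewrite (@soft_threshold0 e 0) ?normr0// !subr0.
Qed.

Lemma soft_threshold_ge e x : 0 <= e -> `|x| - `|soft_threshold e x| <= e.
Proof.
move=> e0; rewrite lerBlDr -lerBlDl; apply: (@le_trans _ _ `|soft_threshold e x|) => //.
have := ler_norm (soft_threshold e x); have := ler_norm (- soft_threshold e x).
rewrite normrN; set n := `|_|; rewrite /soft_threshold maxEle minEle.
case: (ger0P x) => x0; do ! case: ifPn; rewrite -?ltNge => *; lra.
Qed.

(* The term in c^-1 is the one that A2'' makes summable. *)
Lemma powRB1_le s c M p : 4 < p -> 0 <= s -> 0 < M -> M <= c ->
  s `^ (p - 1) <= c * s `^ p + M^-1 `^ (p - 2) * c^-1.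
Proof.
move=> p4 s0 M0 Mc; have c0 : 0 < c by exact: lt_le_trans Mc.
have p1 : 0 <= p - 1 by lra.
have p0 : 0 < p by lra.
(* If [c s >= 1], one more power of s costs only the factor c. Otherwise [s <= c^-1], and all but
   one of the resulting powers of [c^-1] are bounded by powers of [M^-1]. *)
have [cs|cs] := leP 1 (c * s).
  apply: (@le_trans _ _ (c * s `^ p)).
    by rewrite -(mulr_powRB1 s0 p0) mulrA ler_peMl// powR_ge0.
  by rewrite lerDl mulr_ge0 ?powR_ge0// invr_ge0 ltW.
have sc : s <= c^-1 by rewrite -[c^-1]mulr1 ler_pdivlMl// ltW.
have ci0 : 0 <= c^-1 by rewrite invr_ge0 ltW.
apply: (@le_trans _ _ (M^-1 `^ (p - 2) * c^-1)); last first.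
  by rewrite lerDr mulr_ge0 ?powR_ge0// ltW.
apply: (@le_trans _ _ (c^-1 `^ (p - 1))).
  by rewrite ge0_ler_powR ?nnegrE.
rewrite -(mulr_powRB1 ci0); last by lra.
rewrite mulrC (_ : p - 1 - 1 = p - 2); last by ring.
have p2 : 0 <= p - 2 by lra.
have Mi0 : 0 <= M^-1 by rewrite invr_ge0 ltW.
have ciM : c^-1 <= M^-1 by rewrite lef_pV2 ?posrE.
by rewrite ler_wpM2r// ge0_ler_powR.
Qed.

End PointwiseInequalities.

(** * The discrete gradient *)

Section Gradient.
Variables (R : realType) (V : choiceType) (E : rel V) (mu : V -> R).
Hypothesis E_sym : symmetric E.
Hypothesis E_lf : locally_finite E.
Hypothesis mu_gt0 : forall x, 0 < mu x.
Implicit Types u v w : V -> R.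

Lemma gradn_ge0 u x : 0 <= gradn E mu u x.
Proof. exact: sqrtr_ge0. Qed.

Lemma gradn_le u v x : (forall y z, `|u y - u z| <= `|v y - v z|) ->
  gradn E mu u x <= gradn E mu v x.
Proof.
move=> uv; rewrite ler_sqrt; last first.
  rewrite mulr_ge0 ?invr_ge0 ?mulr_ge0 ?(ltW (mu_gt0 _))//.
  by rewrite fsbig_finite//= sumr_ge0// => y _; rewrite sqr_ge0.
rewrite ler_wpM2l ?invr_ge0 ?mulr_ge0 ?(ltW (mu_gt0 _))//.
rewrite !fsbig_finite//= ler_sum// => y _.
by rewrite -[leLHS]real_normK ?num_real// -[leRHS]real_normK ?num_real// lerXn2r.
Qed.

Lemma gradnZ c u x : gradn E mu (c *: u) x = `|c| * gradn E mu u x.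
Proof.
rewrite /gradn -sqrtr_sqr -sqrtrM ?sqr_ge0//; congr Num.sqrt.
rewrite mulrCA; congr (_ * _); rewrite !fsbig_finite//= mulr_sumr.
apply: eq_bigr => y _; rewrite -[(c *: u) y]/(c * u y) -[(c *: u) x]/(c * u x).
by rewrite -mulrBr exprMn.
Qed.

(** From [(s + t)^2 <= 2 (s^2 + t^2)] termwise. The constant 2 is not sharp, but only summability is
    drawn from it. *)
Lemma gradnD u v x :
  gradn E mu (u + v) x <= 2 * (gradn E mu u x + gradn E mu v x).
Proof.
have mui : 0 <= (2 * mu x)^-1 by rewrite invr_ge0 mulr_ge0// ltW.
have S0 w : 0 <= (2 * mu x)^-1 * \sum_(y \in [set y | E x y]) (w y - w x) ^+ 2.
  rewrite mulr_ge0// fsbig_finite//= sumr_ge0// => y _; exact: sqr_ge0.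
rewrite -ler_sqr ?nnegrE ?mulr_ge0 ?addr_ge0 ?gradn_ge0//.
apply: (@le_trans _ _ (2 * (gradn E mu u x ^+ 2 + gradn E mu v x ^+ 2))); last first.
  have := gradn_ge0 u x; have := gradn_ge0 v x; nra.
rewrite !sqr_sqrtr// -mulrDr mulrCA ler_wpM2l//.
rewrite !fsbig_finite//= -big_split/= mulr_sumr ler_sum// => y _.
rewrite -[(u + v) y]/(u y + v y) -[(u + v) x]/(u x + v x).
have := sqr_ge0 ((u y - u x) - (v y - v x)); nra.
Qed.

(** The gradient lives on the support and its neighbours, which are finitely many by local
    finiteness; symmetry of E makes them neighbours as seen from the support. *)
Lemma gradn_finite_support u : finitely_supported u ->
  finite_set [set x | gradn E mu u x != 0].
Proof.
move=> finu.
have : finite_set ([set x | u x != 0] `|`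
    \bigcup_(y in [set x | u x != 0]) [set x | E y x]).
  by rewrite finite_setU; split=> //; exact: bigcup_finite.
apply: sub_finite_set => x /=; apply: contraNP => /not_orP[/negP].
rewrite negbK => /eqP ux /forall2NP uy.
rewrite /gradn fsbig1 ?mulr0 ?sqrtr0// => y Exy.
have [/negP|] := uy y; first by rewrite negbK => /eqP ->; rewrite ux subrr expr0n.
by move=> /negP; rewrite -/(is_true _) /= E_sym Exy.
Qed.

End Gradient.

(** * Energy, coupling and logarithmic densities *)

Section Energy.
Variables (R : realType) (V : choiceType) (E : rel V) (mu : V -> R) (p : R).
Hypothesis E_sym : symmetric E.
Hypothesis E_lf : locally_finite E.
Hypothesis mu_gt0 : forall x, 0 < mu x.
Hypothesis p4 : 4 < p.
Implicit Types (u v w a b : V -> R) (Lam : R).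

Local Notation L1 := (L1 mu setT).
Local Notation rsum := (rsum mu).

Let p_gt0 : 0 < p. Proof. exact: lt_trans p4. Qed.
Let p_neq0 : p != 0. Proof. by rewrite gt_eqF. Qed.

Definition energy Lam a u x : R :=
  gradn E mu u x `^ p + potential Lam a x * `|u x| `^ p.

(** Up to the factor [s^p], the coefficient of [2 ln s] in the scaling law [log_termZ]. *)
Definition coupling u v x : R :=
  `|u x| `^ (p - 2) * v x ^+ 2 + `|v x| `^ (p - 2) * u x ^+ 2.

Lemma potential_ge1 Lam a x : 0 <= Lam -> (forall x, 0 <= a x) ->
  1 <= potential Lam a x.
Proof. by move=> L0 a0; rewrite /potential lerDl mulr_ge0. Qed.

Lemma energy_ge0 Lam a u x : 0 <= Lam -> (forall x, 0 <= a x) ->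
  0 <= energy Lam a u x.
Proof.
move=> L0 a0; rewrite addr_ge0 ?mulr_ge0 ?powR_ge0//.
by rewrite (le_trans ler01)// potential_ge1.
Qed.

Lemma coupling_ge0 u v x : 0 <= coupling u v x.
Proof. by rewrite addr_ge0// mulr_ge0 ?powR_ge0 ?sqr_ge0. Qed.

Lemma powRD_le (s t : R) : 0 <= s -> 0 <= t ->
  (2 * (s + t)) `^ p <= 4 `^ p * (s `^ p + t `^ p).
Proof.
move=> s0 t0; have [st|/ltW ts] := leP s t.
- apply: (@le_trans _ _ ((4 * t) `^ p)).
    by rewrite ge0_ler_powR ?nnegrE ?mulr_ge0 ?addr_ge0 ?(ltW p_gt0)//; lra.
  by rewrite powRM// ler_wpM2l ?powR_ge0// lerDr powR_ge0.
- apply: (@le_trans _ _ ((4 * s) `^ p)).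
    by rewrite ge0_ler_powR ?nnegrE ?mulr_ge0 ?addr_ge0 ?(ltW p_gt0)//; lra.
  by rewrite powRM// ler_wpM2l ?powR_ge0// lerDl powR_ge0.
Qed.

Lemma L1_powR_support (f : V -> R) (q : R) : q != 0 ->
  finite_set [set x | f x != 0] -> L1 (fun x => f x `^ q).
Proof.
move=> q0 finf; apply: L1_finite_support; apply: sub_finite_set finf => x /=.
by apply: contraNN => /eqP ->; rewrite powR0.
Qed.

(** The finiteness condition in [Hspace] concerns the potential part only. For the gradient one
    approximant is enough: [u - phi n] has finite norm, and [phi n] has a finitely supported
    gradient. *)
Lemma L1_energy Lam a u : 0 <= Lam -> (forall x, 0 <= a x) ->
  Hspace E mu p Lam a u -> L1 (energy Lam a u).
Proof.
move=> L0 a0 [[phi [finphi cvphi]] Hfin].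
have pot0 x : 0 <= potential Lam a x.
  by rewrite (le_trans ler01)// potential_ge1.
apply: L1D; last first.
  by apply: L1_gint => // x; rewrite mulr_ge0 ?powR_ge0.
have /filter_ex[n /=] : \forall n \near (\oo : set_system nat),
    (W1p_norm E mu p (u - phi n)%R < 1)%E.
  exact: cvphi _ (open_ereal_lt' lte01).
move=> lt1; have := lt_le_trans lt1 (leey 1%E) => /lty_poweRy.
rewrite invr_eq0 p_neq0 => /(_ isT) /L1_gint => /(_ mu_gt0) L1w.
have {}L1w : L1 (fun x => gradn E mu (u - phi n) x `^ p).
  apply: L1_le; last first.
    by apply: L1w => x; rewrite addr_ge0 ?powR_ge0.
  by move=> x /=; rewrite ger0_norm ?powR_ge0// lerDl powR_ge0.
have L1phi : L1 (fun x => gradn E mu (phi n) x `^ p).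
  by apply: L1_powR_support => //; exact: gradn_finite_support.
apply: L1_le; last exact: (L1Z (4 `^ p) (L1D L1w L1phi)).
move=> x; rewrite ger0_norm ?powR_ge0// (le_trans _ (powRD_le _ _)) ?gradn_ge0//.
rewrite ge0_ler_powR ?nnegrE ?(ltW p_gt0) ?gradn_ge0 ?mulr_ge0 ?addr_ge0 ?gradn_ge0//.
by rewrite -{1}(subrK (phi n) u) gradnD.
Qed.

Lemma W1p_finitely_supported u : finitely_supported u -> W1p E mu p u.
Proof.
move=> finu; exists (fun=> u); split=> // [].
rewrite (_ : W1p_norm E mu p (u - u) = 0%E); first exact: cvg_cst.
rewrite /W1p_norm gint_ge0//; last by move=> x; rewrite addr_ge0 ?powR_ge0.
rewrite esum1 ?poweR0r ?invr_eq0// => x _.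
rewrite subrr normr0 powR0// addr0 /gradn fsbig1 ?mulr0 ?sqrtr0 ?powR0 ?mul0r//.
by move=> y _; rewrite subrr expr0n.
Qed.

Lemma Hspace_finitely_supported Lam a u : 0 <= Lam -> (forall x, 0 <= a x) ->
  finitely_supported u -> Hspace E mu p Lam a u.
Proof.
move=> L0 a0 finu; split; first exact: W1p_finitely_supported.
rewrite gint_rsum ?ltry//.
  move=> x; rewrite mulr_ge0 ?powR_ge0//.
  by rewrite (le_trans ler01)// potential_ge1.
apply: L1_finite_support; apply: sub_finite_set finu => x /=.
by apply: contraNN => /eqP ->; rewrite normr0 powR0 ?mulr0.
Qed.

Lemma J_rsum a b Lam u v : 0 <= Lam ->
  (forall x, 0 <= a x) -> (forall x, 0 <= b x) ->
  J E mu p a b Lam (u, v) =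
  p^-1 * (rsum (energy Lam a u) + rsum (energy Lam b v)
          - rsum (log_term p u v)).
Proof.
move=> L0 a0 b0; rewrite mulrBr /J /=; congr (_ * _ - _).
have H c w : (forall x, 0 <= c x) ->
    Hnorm E mu p Lam c w `^ p = rsum (energy Lam c w).
  move=> c0; rewrite /Hnorm fine_poweR -powRrM mulVf// powRr1//.
  by apply: rsum_ge0 => // x; exact: energy_ge0.
by rewrite !H.
Qed.

Lemma energyZ Lam a u (s : R) x : 0 < s ->
  energy Lam a (s *: u) x = s `^ p * energy Lam a u x.
Proof.
move=> s0; rewrite /energy gradnZ// gtr0_norm// powRM ?gradn_ge0 ?(ltW s0)//.
rewrite -[(s *: u) x]/(s * u x) normrM gtr0_norm// powRM ?(ltW s0)//.
by ring.
Qed.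

Lemma couplingZ u v (s : R) x : 0 < s ->
  coupling (s *: u) (s *: v) x = s `^ p * coupling u v x.
Proof.
move=> s0; have -> : s `^ p = s `^ (p - 2) * s ^+ 2.
  rewrite -powR_mulrn ?ltW// -powRD ?subrK//.
  by rewrite (gt_eqF s0) implybT.
rewrite /coupling -[(s *: u) x]/(s * u x) -[(s *: v) x]/(s * v x).
rewrite !normrM gtr0_norm// !powRM ?(ltW s0)// !exprMn.
by ring.
Qed.

Lemma log_termZ u v (s : R) x : 0 < s ->
  log_term p (s *: u) (s *: v) x =
  s `^ p * (log_term p u v x + 2 * ln s * coupling u v x).
Proof.
move=> s0; have -> : s `^ p = s `^ (p - 2) * s ^+ 2.
  rewrite -powR_mulrn ?ltW// -powRD ?subrK//.
  by rewrite (gt_eqF s0) implybT.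
rewrite /coupling /log_term -[(s *: u) x]/(s * u x) -[(s *: v) x]/(s * v x).
rewrite !normrM gtr0_norm// !powRM ?(ltW s0)//.
have H (y : R) : (s * y) ^+ 2 * ln ((s * y) ^+ 2) =
    s ^+ 2 * (y ^+ 2 * ln (y ^+ 2) + 2 * ln s * y ^+ 2).
  have [->|y0] := eqVneq y 0; first by rewrite mulr0 expr0n/= !(mul0r, mulr0, addr0).
  have y20 : 0 < y ^+ 2 by rewrite exprn_even_gt0.
  have s20 : 0 < s ^+ 2 by rewrite exprn_gt0.
  rewrite exprMn lnM ?posrE// (lnXn 2 s0) -mulr_natl.
  by ring.
by rewrite !H; ring.
Qed.

Definition admissible Lam a b u v := [/\ L1 (energy Lam a u),
  L1 (energy Lam b v), L1 (coupling u v) & L1 (log_term p u v)].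

(** This is [p J] at (u, v), by [J_rsum]. *)
Definition action Lam a b u v : R :=
  rsum (energy Lam a u) + rsum (energy Lam b v) - rsum (log_term p u v).

(** * The functional along rays and the Nehari manifold *)

Section Fibering.
Variables (Lam : R) (a b u v : V -> R).
Hypothesis Lam_ge0 : 0 <= Lam.
Hypothesis a_ge0 : forall x, 0 <= a x.
Hypothesis b_ge0 : forall x, 0 <= b x.
Hypothesis adm : admissible Lam a b u v.

(** Homogeneity up to a logarithm makes J on a ray an explicit function of s, which can be
    differentiated without exchanging derivative and sum. *)
Lemma JZ (s : R) : 0 < s ->
  J E mu p a b Lam (s *: (u, v)) =
  p^-1 * (s `^ p * (action Lam a b u v - 2 * ln s * rsum (coupling u v))).
Proof.
move=> s0; have [L1a L1b L1k L1l] := adm.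
rewrite -[s *: _]/(s *: u, s *: v) J_rsum//; congr (_ * _).
rewrite (funext (fun x => energyZ Lam a u x s0)) (rsumZ mu_gt0 _ L1a).
rewrite (funext (fun x => energyZ Lam b v x s0)) (rsumZ mu_gt0 _ L1b).
have L1kl := L1Z (2 * ln s) L1k.
rewrite (funext (fun x => log_termZ u v x s0)) (rsumZ mu_gt0 _ (L1D L1l L1kl)).
by rewrite (rsumD mu_gt0 L1l L1kl) (rsumZ mu_gt0 _ L1k) /action; ring.
Qed.

Lemma deriv_along_J : deriv_along (J E mu p a b Lam) (u, v) (u, v)
  (action Lam a b u v - 2 / p * rsum (coupling u v)).
Proof.
set A := action _ _ _ _ _; set K := rsum (coupling _ _).
have D : is_derive (0 : R) (1 : R)
    (p^-1 \*: (((fun s => s `^ p) \o (fun t => 1 + t)) *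
     ((cst A) - ((2 * K) \*: (@ln R \o (fun t => 1 + t)))))) (A - 2 / p * K).
  have D1 : is_derive (0 : R) (1 : R) (fun t : R => 1 + t) 1.
    have := is_deriveD (is_derive_cst (1 : R) (0 : R) (1 : R))
      (is_derive_id (0 : R) (1 : R)).
    by rewrite add0r.
  have D2 : is_derive (0 : R) (1 : R) ((fun s => s `^ p) \o (fun t => 1 + t)) p.
    apply: is_derive_eq.
      apply: is_derive1_comp; apply: is_derive1_powR; by rewrite addr0.
    by rewrite addr0 powR1 !mulr1.
  have D3 : is_derive (0 : R) (1 : R) (@ln R \o (fun t => 1 + t)) 1.
    apply: is_derive_eq.
      apply: is_derive1_comp; apply: is_derive1_ln; by rewrite addr0.
    by rewrite addr0 invr1 mulr1.
  apply: (is_derive_eq (is_deriveZ p^-1 (is_deriveM D2 (is_deriveB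
    (is_derive_cst A (0 : R) (1 : R)) (is_deriveZ (2 * K) D3))))).
  rewrite -[LHS]/(p^-1 * ((1 + 0) `^ p * (0 - 2 * K * 1) +
    (A - 2 * K * ln (1 + 0)) * p)) addr0 powR1 ln1.
  by field.
(* [JZ] holds for positive factors, hence for [1 + t] with t near 0. *)
apply: near_eq_is_derive D; near=> t.
have t0 : 0 < 1 + t.
  rewrite -ltrBlDl sub0r; near: t.
  by apply: lt_nbhsr; rewrite ltrN10.
rewrite -{1}[(u, v)]scale1r -scalerDl JZ// -/A -/K.
rewrite -[LHS]/(p^-1 * ((1 + t) `^ p * (A - 2 * K * ln (1 + t)))).
by congr (_ * (_ * (_ - _))); rewrite mulrAC.
Unshelve. all: by end_near.
Qed.

Lemma Nehari_action : Nehari E mu p a b Lam (u, v) ->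
  action Lam a b u v = 2 / p * rsum (coupling u v).
Proof.
move=> [_ _ _ /= D]; apply/eqP; rewrite -subr_eq0; apply/eqP.
by rewrite -(@derive_val _ _ _ _ _ _ _ deriv_along_J) (@derive_val _ _ _ _ _ _ _ D).
Qed.

Lemma Nehari_J : Nehari E mu p a b Lam (u, v) ->
  J E mu p a b Lam (u, v) = 2 / p ^+ 2 * rsum (coupling u v).
Proof.
move=> /Nehari_action H; rewrite J_rsum// -/(action Lam a b u v) H.
by field.
Qed.

End Fibering.

Lemma admissible_finitely_supported Lam a b u v :
  finitely_supported u -> finitely_supported v -> admissible Lam a b u v.
Proof.
have L1e c w : finitely_supported w -> L1 (energy Lam c w).
  move=> finw; apply: L1D.
    by apply: L1_powR_support => //; exact: gradn_finite_support.
  apply: L1_finite_support; apply: sub_finite_set finw => x /=.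
  by apply: contraNN => /eqP ->; rewrite normr0 powR0 ?mulr0.
move=> finu finv; have p2 : p - 2 != 0.
  by rewrite subr_eq0 gt_eqF// (lt_trans _ p4)// ltr_nat.
split; [exact: L1e|exact: L1e| |];
  apply: L1_finite_support; apply: sub_finite_set finu => x /=;
  apply: contraNN => /eqP.
- by rewrite /coupling => ->; rewrite normr0 powR0// expr0n mul0r mulr0 addr0.
- by rewrite /log_term => ->; rewrite normr0 powR0// expr0n !mul0r mulr0 addr0.
Qed.

(* The right-hand side is p^2/2 times the maximum of J along the ray through
   (u, v), which is attained on the Nehari manifold. *)
Lemma ground_state_coupling_le Lam a b u0 v0 u v : 0 <= Lam ->
  (forall x, 0 <= a x) -> (forall x, 0 <= b x) ->
  admissible Lam a b u0 v0 -> ground_state E mu p a b Lam (u0, v0) ->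
  finitely_supported u -> finitely_supported v -> 0 < rsum (coupling u v) ->
  rsum (coupling u0 v0) <= rsum (coupling u v) *
    expR (p / 2 * (action Lam a b u v / rsum (coupling u v)) - 1).
Proof.
move=> L0 a0 b0 adm0 [N0 J0] finu finv K0.
have adm := admissible_finitely_supported Lam a b finu finv.
set K := rsum (coupling u v) in K0 *; set A := action _ _ _ _ _.
(* The critical point of [s^p (A - 2 K ln s)] on the positive half-line, where
   [A - 2 K ln s = 2 K / p]. *)
set s := expR ((A / K - 2 / p) / 2); have s0 : 0 < s by exact: expR_gt0.
have finZ w : finitely_supported w -> finitely_supported (s *: w).
  apply: sub_finite_set => x /=; apply: contraNN => /eqP wx.
  by rewrite -[(s *: w) x]/(s * w x) wx mulr0.
have adms := admissible_finitely_supported Lam a b (finZ _ finu) (finZ _ finv).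
have sp : s `^ p = expR (p / 2 * (A / K) - 1).
  by rewrite /powR gt_eqF// /s expRK; congr expR; field; rewrite p_neq0 gt_eqF.
have Ks : rsum (coupling (s *: u) (s *: v)) = s `^ p * K.
  have [_ _ L1k _] := adm.
  by rewrite (funext (fun x => couplingZ u v x s0)) (rsumZ mu_gt0 _ L1k).
have As : action Lam a b (s *: u) (s *: v) = 2 / p * (s `^ p * K).
  apply: (mulfI (invr_neq0 p_neq0)).
  rewrite -[LHS](J_rsum (s *: u) (s *: v))// -[(_, _)]/(s *: (u, v)) JZ//.
  rewrite -/A -/K /s expRK; field.
  by rewrite p_neq0 gt_eqF.
have Ns : Nehari E mu p a b Lam (s *: u, s *: v).
  split.
  - by apply: Hspace_finitely_supported => //; exact: finZ.
  - by apply: Hspace_finitely_supported => //; exact: finZ.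
  - move=> [su sv]; have : 0 < s `^ p * K by rewrite mulr_gt0 ?powR_gt0.
    rewrite -Ks su sv (_ : coupling 0 0 = fun=> 0) ?rsum0 ?ltxx//.
    by apply/funext => x; rewrite /coupling expr0n !mulr0 addr0.
  - have := deriv_along_J L0 a0 b0 adms.
    by rewrite As Ks subrr.
have J_le : J E mu p a b Lam (u0, v0) <= J E mu p a b Lam (s *: u, s *: v).
  by rewrite -lee_fin J0; apply: ereal_inf_lbound; exists (s *: u, s *: v).
move: J_le; rewrite (Nehari_J L0 a0 b0 adm0 N0) (Nehari_J L0 a0 b0 adms Ns).
by rewrite ler_pM2l ?divr_gt0 ?exprn_gt0// Ks sp mulrC.
Qed.

(** * Summability of the powers [p - 1] from (A2'') *)

Lemma L1_indicator (A : set V) (f : V -> R) :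
  Defs.L1 mu A f -> L1 (fun x => if x \in A then f x else 0).
Proof.
rewrite /Defs.L1 /summable esum_mkcond; apply: le_lt_trans.
by apply: le_esum => x _; case: ifPn => // _; rewrite mul0r abse_EFin normr0.
Qed.

(** The part of the bound on [|u|^(p-1)] that depends on neither u nor Lam. Its two branches are
    summable by the two halves of (A2''). *)
Definition tail_weight a (M : R) x : R :=
  if a x <= M then 1 else M^-1 `^ (p - 2) * (a x)^-1.

Lemma tail_weight_ge0 a (M : R) x : (forall x, 0 <= a x) -> 0 <= tail_weight a M x.
Proof.
by move=> a0; rewrite /tail_weight; case: ifP => // _;
  rewrite mulr_ge0 ?powR_ge0 ?invr_ge0.
Qed.

Lemma L1_tail_weight a (M : R) : (forall x, 0 <= a x) -> 0 < M ->
  (volume mu (sublevel a M) < +oo)%E ->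
  Defs.L1 mu (~` (sublevel a M `|` zeros a)) (fun x => (a x)^-1) ->
  L1 (tail_weight a M).
Proof.
move=> a0 M0 vola tail.
have L1s : Defs.L1 mu (sublevel a M) (fun=> 1).
  apply: le_lt_trans vola; apply: le_esum => x _.
  by rewrite mul1r gee0_abs// lee_fin ltW.
have := L1D (L1_indicator L1s) (L1Z (M^-1 `^ (p - 2)) (L1_indicator tail)).
apply: L1_le => x; rewrite ger0_norm ?tail_weight_ge0// /tail_weight.
have ta y : 0 <= M^-1 `^ (p - 2) * (a y)^-1.
  by rewrite mulr_ge0 ?powR_ge0 ?invr_ge0.
case: ifPn => [aM|]; last rewrite -ltNge => Ma.
  rewrite (mem_set (aM : sublevel a M x)).
  by case: ifP => _; rewrite ?mulr0 ?addr0// lerDl.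
have -> : (x \in sublevel a M) = false.
  by apply/negbTE; rewrite notin_setE /sublevel/= leNgt Ma.
(* As [M > 0], a point with [a x > M] is not a zero of a. *)
rewrite add0r ifT// inE => -[|]; rewrite /sublevel/zeros/=.
  by rewrite leNgt Ma.
by move=> ax; move: Ma; rewrite ax ltNge (ltW M0).
Qed.

Lemma energy_ge_powR Lam a u x : 0 <= Lam -> (forall x, 0 <= a x) ->
  `|u x| `^ p <= energy Lam a u x.
Proof.
move=> L0 a0; rewrite (@le_trans _ _ (potential Lam a x * `|u x| `^ p))//.
  by rewrite ler_peMl ?powR_ge0// potential_ge1.
by rewrite lerDr powR_ge0.
Qed.

Lemma energy_ge_potential Lam a u x : 0 <= Lam -> (forall x, 0 <= a x) ->
  Lam * a x * `|u x| `^ p <= energy Lam a u x.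
Proof.
move=> L0 a0; rewrite (@le_trans _ _ (potential Lam a x * `|u x| `^ p))//.
  by rewrite ler_wpM2r ?powR_ge0// /potential lerDr.
by rewrite lerDr powR_ge0.
Qed.

(** Where [a <= M], [|u|^(p-1) <= 1 + |u|^p]. Elsewhere [powRB1_le] applies with [c = a x], and
    [Lam >= 1] absorbs [a x |u|^p] into the energy. *)
Lemma powRB1_le_tail_weight Lam a (M : R) u x : 1 <= Lam -> (forall x, 0 <= a x) ->
  0 < M -> `|u x| `^ (p - 1) <= tail_weight a M x + energy Lam a u x.
Proof.
move=> Lam1 a0 M0; have L0 : 0 <= Lam by exact: le_trans Lam1.
have p1 : 0 <= p - 1 by rewrite subr_ge0 (le_trans _ (ltW p4))// ler1n.
rewrite /tail_weight; case: ifPn => [_|]; last rewrite -ltNge => Ma.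
- have [u1|u1] := leP `|u x| 1.
    rewrite (@le_trans _ _ 1)//; last by rewrite lerDl energy_ge0.
    apply: (@le_trans _ _ (1 `^ (p - 1))); last by rewrite powR1.
    by rewrite ge0_ler_powR ?nnegrE.
  rewrite (@le_trans _ _ (`|u x| `^ p))//.
    by rewrite ler_powR ?(ltW u1)// lerBlDr lerDl.
  by rewrite (le_trans (energy_ge_powR _ _ L0 a0))// lerDr.
- rewrite (le_trans (powRB1_le p4 (normr_ge0 _) M0 (ltW Ma)))// addrC lerD2l.
  rewrite (le_trans _ (energy_ge_potential _ _ L0 a0))//.
  by rewrite ler_wpM2r ?powR_ge0// ler_peMl.
Qed.

Lemma L1_powRB1 Lam a (M : R) u : 1 <= Lam -> (forall x, 0 <= a x) -> 0 < M ->
  L1 (tail_weight a M) -> L1 (energy Lam a u) ->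
  L1 (fun x => `|u x| `^ (p - 1)).
Proof.
move=> Lam1 a0 M0 L1t L1e; apply: L1_le (L1D L1t L1e) => x.
by rewrite ger0_norm ?powR_ge0// powRB1_le_tail_weight.
Qed.

Lemma rsum_powRB1_le Lam a (M : R) u : 1 <= Lam -> (forall x, 0 <= a x) -> 0 < M ->
  L1 (tail_weight a M) -> L1 (energy Lam a u) ->
  rsum (fun x => `|u x| `^ (p - 1)) <=
  rsum (tail_weight a M) + rsum (energy Lam a u).
Proof.
move=> Lam1 a0 M0 L1t L1e; rewrite -rsumD// le_rsum//.
- exact: L1_powRB1 L1t L1e.
- exact: L1D.
- by move=> x; exact: powRB1_le_tail_weight.
Qed.

Lemma coupling_le_energy Lam a b u v x : 0 <= Lam ->
  (forall x, 0 <= a x) -> (forall x, 0 <= b x) ->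
  coupling u v x <= 2 * (energy Lam a u x + energy Lam b v x).
Proof.
move=> L0 a0 b0; have p2 : 0 < p - 2.
  by rewrite subr_gt0 (lt_trans _ p4)// ltr_nat.
have H (s t : R) : 0 <= s -> 0 <= t -> s `^ (p - 2) * t ^+ 2 <= s `^ p + t `^ p.
  move=> s0 t0; rewrite -{2 3}(subrK 2 p).
  exact: (@powR_mulXn_le _ s t (p - 2) 2 s0 t0 p2).
have := H `|u x| `|v x| (normr_ge0 _) (normr_ge0 _).
have := H `|v x| `|u x| (normr_ge0 _) (normr_ge0 _).
have := energy_ge_powR u x L0 a0; have := energy_ge_powR v x L0 b0.
rewrite !real_normK ?num_real// /coupling; nra.
Qed.

Lemma log_term_norm_le u v x (M : R) : `|u x| <= M -> `|v x| <= M ->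
  `|log_term p u v x| <=
  4 * (M ^+ 2 + 1) * (`|u x| `^ (p - 1) + `|v x| `^ (p - 1)).
Proof.
move=> uM vM; have p2 : 0 < p - 2.
  by rewrite subr_gt0 (lt_trans _ p4)// ltr_nat.
have M1 : 0 <= 2 * (M ^+ 2 + 1) by rewrite mulr_ge0// addr_ge0// sqr_ge0.
have H (s t : R) : 0 <= s -> 0 <= t -> t <= M -> `|s `^ (p - 2) *
    (t ^+ 2 * ln (t ^+ 2))| <= 2 * (M ^+ 2 + 1) * (s `^ (p - 1) + t `^ (p - 1)).
  move=> s0 t0 tM; rewrite normrM ger0_norm ?powR_ge0//.
  apply: (@le_trans _ _ (s `^ (p - 2) * (2 * (M ^+ 2 + 1) * t))).
    by rewrite ler_wpM2l ?powR_ge0// sqr_ln_sqr_le.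
  rewrite mulrCA ler_wpM2l//.
  have -> : p - 1 = p - 2 + 1%:R by ring.
  by rewrite -[X in _ * X]expr1 powR_mulXn_le.
rewrite /log_term -[v x ^+ 2]real_normK ?num_real//.
rewrite -[u x ^+ 2]real_normK ?num_real// (le_trans (ler_normD _ _))//.
have := H `|u x| `|v x| (normr_ge0 _) (normr_ge0 _) vM.
have := H `|v x| `|u x| (normr_ge0 _) (normr_ge0 _) uM.
set z1 := `|_ * _|; set z2 := `|_ * _|; nra.
Qed.

End Energy.

(** * A priori estimates under a positive lower bound on mu *)

Section Estimates.
Variables (R : realType) (V : choiceType) (E : rel V) (mu : V -> R).
Variables (mumin p : R).
Hypothesis E_sym : symmetric E.
Hypothesis E_lf : locally_finite E.
Hypothesis mumin_gt0 : 0 < mumin.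
Hypothesis mumin_le : forall x, mumin <= mu x.
Hypothesis p4 : 4 < p.
Implicit Types (u v a b : V -> R) (Lam : R).

Local Notation L1 := (L1 mu setT).
Local Notation rsum := (rsum mu).

Let mu_gt0 x : 0 < mu x. Proof. exact: lt_le_trans (mumin_le x). Qed.
Let p_gt0 : 0 < p. Proof. exact: lt_trans p4. Qed.

(** Any n points have volume at least [n mumin]. This makes the zero sets finite, so that the
    thresholded competitors are finitely supported. *)
Lemma finite_volume_finite (A : set V) : (volume mu A < +oo)%E -> finite_set A.
Proof.
move=> volA; apply: contrapT => infA.
have vol0 : (0 <= volume mu A)%E.
  by apply: esum_ge0 => x _; rewrite lee_fin ltW.
have [n Hn] : exists n : nat, fine (volume mu A) < mumin * n%:R.
  exists (Num.truncn (fine (volume mu A) / mumin)).+1.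
  by rewrite -ltr_pdivrMl// mulrC truncnS_gt.
have [B BA nB] := infinite_set_fset n infA.
have : (volume mu A < (mumin * n%:R)%:E)%E.
  by rewrite -[ltLHS]fineK ?lte_fin// ge0_fin_numE.
rewrite ltNge => /negP; apply; apply: esum_ge.
exists [set` B]; first by split => //; exact: finite_fset.
rewrite fsbig_finite ?finite_fset//= set_fsetK sumEFin lee_fin.
apply: (@le_trans _ _ (\sum_(i <- B) mumin)); last by apply: ler_sum.
rewrite big_const_seq count_predT iter_addr_0 -[leRHS]mulr_natr.
by rewrite ler_wpM2l ?(ltW mumin_gt0)// ler_nat.
Qed.

Lemma powR_mumin_le Lam a u x : 0 <= Lam -> (forall x, 0 <= a x) ->
  L1 (energy E mu p Lam a u) -> `|u x| `^ p <= rsum (energy E mu p Lam a u) / mumin.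
Proof.
move=> L0 a0 L1e; rewrite ler_pdivlMr//.
apply: le_trans (rsum_ge_pt mu_gt0 x _ L1e); last first.
  by move=> y; exact: energy_ge0.
rewrite ler_pM ?powR_ge0 ?(ltW mumin_gt0)//.
exact: energy_ge_powR.
Qed.

(** A single term of the energy sum already carries the weight [Lam * a0 * mumin]; this makes u
    uniformly small off the zeros for large Lam. *)
Lemma powR_potential_le Lam a u x (a0 : R) : 0 < Lam -> (forall x, 0 <= a x) ->
  0 < a0 -> a0 <= a x -> L1 (energy E mu p Lam a u) ->
  `|u x| `^ p <= rsum (energy E mu p Lam a u) / (Lam * a0 * mumin).
Proof.
move=> L0 a_ge0 a00 aax L1e; rewrite ler_pdivlMr ?mulr_gt0//.
apply: le_trans (rsum_ge_pt mu_gt0 x _ L1e); last first.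
  by move=> y; apply: energy_ge0 => //; exact: ltW.
rewrite mulrA ler_pM ?(ltW mumin_gt0)//.
  by rewrite mulr_ge0 ?powR_ge0// mulr_ge0// ltW.
rewrite (le_trans _ (energy_ge_potential E mu p u x (ltW L0) a_ge0))//.
by rewrite mulrC ler_wpM2r ?powR_ge0// ler_wpM2l// ltW.
Qed.

Lemma powR_root_le (s B : R) : 0 <= s -> 0 <= B -> s `^ p <= B -> s <= B `^ p^-1.
Proof.
move=> s0 B0 sB; rewrite -[leLHS](powRr1 s0) -(divff (lt0r_neq0 p_gt0)) powRrM.
by rewrite ge0_ler_powR ?nnegrE ?invr_ge0 ?(ltW p_gt0) ?powR_ge0.
Qed.

Lemma ln_sqr_le (s B : R) : 1 <= B -> `|s| `^ p <= B ->
  ln (s ^+ 2) <= 2 / p * ln B.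
Proof.
move=> B1 sB; have B0 : 0 < B by exact: lt_le_trans B1.
have [->|s0] := eqVneq s 0.
  by rewrite expr0n/= ln0// mulr_ge0 ?ln_ge0// divr_ge0// ltW.
have sp : 0 < `|s| by rewrite normr_gt0.
have : ln (`|s| `^ p) <= ln B by rewrite ler_ln ?posrE ?powR_gt0.
rewrite ln_powR -[s ^+ 2]real_normK ?num_real// lnXn// -[ln _ *+ 2]mulr_natl => H.
by rewrite -mulrA ler_wpM2l// mulrC ler_pdivlMr// mulrC.
Qed.

(** The energy bounds the sup norms; the logarithms then cost only a constant, and the powers
    [p - 1] dominate the logarithmic term. *)
Lemma admissible_Hspace Lam a b u v (M : R) : 1 <= Lam ->
  (forall x, 0 <= a x) -> (forall x, 0 <= b x) -> 0 < M ->
  L1 (tail_weight p a M) -> L1 (tail_weight p b M) ->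
  Hspace E mu p Lam a u -> Hspace E mu p Lam b v -> admissible E mu p Lam a b u v.
Proof.
move=> Lam1 a0 b0 M0 L1ta L1tb Hu Hv.
have L0 : 0 <= Lam by exact: le_trans Lam1.
have L1a : L1 (energy E mu p Lam a u) by exact: L1_energy Hu.
have L1b : L1 (energy E mu p Lam b v) by exact: L1_energy Hv.
split=> //.
- apply: L1_le (L1Z 2 (L1D L1a L1b)) => x.
  by rewrite ger0_norm ?coupling_ge0// coupling_le_energy.
- have B0 c w : (forall x, 0 <= c x) -> 0 <= rsum (energy E mu p Lam c w) / mumin.
    move=> c0; apply: divr_ge0; last exact: ltW.
    by apply: rsum_ge0 => // x; exact: energy_ge0.
  set Mu := (rsum (energy E mu p Lam a u) / mumin) `^ p^-1.
  set Mv := (rsum (energy E mu p Lam b v) / mumin) `^ p^-1.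
  have uM x : `|u x| <= Num.max Mu Mv.
    rewrite le_max; apply/orP; left; apply: powR_root_le; [by []|exact: B0|].
    exact: powR_mumin_le.
  have vM x : `|v x| <= Num.max Mu Mv.
    rewrite le_max; apply/orP; right; apply: powR_root_le; [by []|exact: B0|].
    exact: powR_mumin_le.
  have L1u := L1_powRB1 p4 Lam1 a0 M0 L1ta L1a.
  have L1v := L1_powRB1 p4 Lam1 b0 M0 L1tb L1b.
  apply: L1_le (L1Z (4 * (Num.max Mu Mv ^+ 2 + 1)) (L1D L1u L1v)) => x.
  exact: log_term_norm_le.
Qed.

(* mu x >= mumin turns the energy N into a bound N / mumin for |u|^p and |v|^p,
   hence ln u^2 <= (2 / p) ln (N / mumin). *)
Lemma Nehari_energy_le Lam a b u v (N : R) : 0 <= Lam ->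
  (forall x, 0 <= a x) -> (forall x, 0 <= b x) ->
  admissible E mu p Lam a b u v -> Nehari E mu p a b Lam (u, v) ->
  N = rsum (energy E mu p Lam a u) + rsum (energy E mu p Lam b v) ->
  N <= 2 / p * (ln (N / mumin) + 1) * rsum (coupling p u v).
Proof.
move=> L0 a0 b0 adm NN NE; have [L1a L1b L1k L1l] := adm.
have Na0 c w : (forall x, 0 <= c x) -> 0 <= rsum (energy E mu p Lam c w).
  by move=> c0; apply: rsum_ge0 => // x; exact: energy_ge0.
have lnle (s : R) : `|s| `^ p <= N / mumin ->
    s ^+ 2 * ln (s ^+ 2) <= 2 / p * ln (N / mumin) * s ^+ 2.
  have [->|s0] := eqVneq s 0; first by rewrite expr0n/= mul0r mulr0.
  have sp : 0 < `|s| by rewrite normr_gt0.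
  move=> sN; have N0 : 0 < N / mumin by apply: lt_le_trans sN; rewrite powR_gt0.
  have : ln (`|s| `^ p) <= ln (N / mumin) by rewrite ler_ln ?posrE ?powR_gt0.
  rewrite ln_powR => H; rewrite [leLHS]mulrC ler_wpM2r ?sqr_ge0//.
  rewrite -[s ^+ 2]real_normK ?num_real// lnXn// -[ln _ *+ 2]mulr_natl.
  by rewrite -mulrA ler_wpM2l// mulrC ler_pdivlMr// mulrC.
have I_le : rsum (log_term p u v) <= 2 / p * ln (N / mumin) * rsum (coupling p u v).
  rewrite -rsumZ// le_rsum//; first exact: L1Z.
  move=> x; rewrite /log_term /coupling mulrDr.
  apply: lerD; rewrite [leRHS]mulrCA ler_wpM2l ?powR_ge0//; apply: lnle.
    apply: (le_trans (powR_mumin_le x L0 b0 L1b)).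
    by rewrite ler_wpM2r ?invr_ge0 ?(ltW mumin_gt0)// NE lerDr Na0.
  apply: (le_trans (powR_mumin_le x L0 a0 L1a)).
  by rewrite ler_wpM2r ?invr_ge0 ?(ltW mumin_gt0)// NE lerDl Na0.
(* On the Nehari manifold [N - I = 2 K / p], which supplies the summand 1 next to the logarithm. *)
have := Nehari_action E_lf mu_gt0 p4 L0 a0 b0 adm NN.
rewrite /action -NE mulrDr mulr1 mulrDl.
by move=> NI; rewrite -lerBlDr -NI subKr.
Qed.

Lemma Nehari_energy_gt0 Lam a b u v : 0 <= Lam ->
  (forall x, 0 <= a x) -> (forall x, 0 <= b x) ->
  admissible E mu p Lam a b u v -> Nehari E mu p a b Lam (u, v) ->
  0 < rsum (energy E mu p Lam a u) + rsum (energy E mu p Lam b v).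
Proof.
move=> L0 a0 b0 [L1a L1b _ _] [_ _ /= w0 _].
have Na0 c w : (forall x, 0 <= c x) -> 0 <= rsum (energy E mu p Lam c w).
  by move=> c0; apply: rsum_ge0 => // x; exact: energy_ge0.
rewrite lt_neqAle addr_ge0 ?Na0// andbT; apply/eqP => /esym/eqP.
rewrite paddr_eq0 ?Na0// => /andP[/eqP Nu /eqP Nv]; apply: w0.
have eq0 c w : (forall x, 0 <= c x) -> L1 (energy E mu p Lam c w) ->
    rsum (energy E mu p Lam c w) = 0 -> w = 0.
  move=> c0 L1w Nw; apply/funext => x; apply/eqP; rewrite -normr_eq0.
  have := powR_mumin_le x L0 c0 L1w; rewrite Nw mul0r => wx.
  apply/eqP; apply: (@powR_eq0_eq0 _ _ p); apply/eqP.
  by rewrite eq_le wx powR_ge0.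
by rewrite (eq0 a u)// (eq0 b v).
Qed.

(** An explicit bound on the N with [N <= (2 / p) (ln (N / mumin) + 1) D]. The summand mumin keeps
    it at least mumin. *)
Definition energy_bound (D : R) : R :=
  4 * D / p * `|ln (4 * D / (p * mumin))| + mumin.

Lemma le_energy_bound (N K D : R) : 0 < N -> 0 <= K -> K <= D -> 0 < D ->
  N <= 2 / p * (ln (N / mumin) + 1) * K -> N <= energy_bound D.
Proof.
move=> N0 K0 KD D0 NK; set y := N / mumin in NK.
have y0 : 0 < y by rewrite divr_gt0.
(* A negative factor would contradict [0 < N]; its sign allows K to be replaced by D. *)
have ly0 : 0 <= ln y + 1.
  rewrite leNgt; apply/negP => ly.
  have := lt_le_trans N0 NK; rewrite ltNge => /negP; apply.
  by rewrite mulr_le0_ge0// mulr_ge0_le0 ?ltW ?divr_gt0.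
(* With this c, the linear term of [ln y <= y / c - 1 + ln c] contributes exactly [N / 2], which is
   absorbed on the left. *)
set c := 4 * D / (p * mumin).
have c0 : 0 < c by rewrite !(divr_gt0, mulr_gt0).
have lnyc : ln y + 1 <= y / c + `|ln c|.
  have yc : 0 < y / c by rewrite divr_gt0.
  have : ln (1 + (y / c - 1)) <= y / c - 1 by rewrite le_ln1Dx// ltrBrDr addNr.
  rewrite addrC subrK ln_div ?posrE// => h.
  have := ler_norm (ln c); lra.
have : N <= 2 / p * (y / c + `|ln c|) * D.
  have p0 : 0 <= 2 / p by rewrite divr_ge0// ltW.
  by apply: (le_trans NK); apply: ler_pM => //; [exact: mulr_ge0|rewrite ler_wpM2l].
have -> : 2 / p * (y / c + `|ln c|) * D = N / 2 + 2 * D / p * `|ln c|.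
  by rewrite /y /c; field; rewrite !gt_eqF.
have -> : energy_bound D = 2 * (2 * D / p * `|ln c|) + mumin.
  by rewrite /energy_bound -/c; field; rewrite gt_eqF.
have := mumin_gt0; lra.
Qed.

(** Below mumin the logarithm would be negative, giving [N <= 2 K / p <= 4 N / p < N], the last step
    by [p > 4]. *)
Lemma energy_ge_mumin (N K : R) : 0 < N -> 0 <= K -> K <= 2 * N ->
  N <= 2 / p * (ln (N / mumin) + 1) * K -> mumin <= N.
Proof.
move=> N0 K0 KN NK; set y := N / mumin in NK.
have y0 : 0 < y by rewrite divr_gt0.
rewrite -[leLHS]mul1r -ler_pdivlMr// -/y leNgt; apply/negP => y1.
have ly : ln y < 0 by rewrite ln_lt0// y0.
have : N <= 2 / p * K.
  apply: (le_trans NK); rewrite ler_wpM2r//.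
  by rewrite ler_piMr ?divr_ge0 ?(ltW p_gt0)//; lra.
rewrite mulrAC ler_pdivlMr//; have := p4; nra.
Qed.

(** * Testing at a common zero, and bounds uniform in Lam *)

Definition indicator_pt (x0 x : V) : R := (x == x0)%:R.

Lemma indicator_pt_support x0 : finitely_supported (indicator_pt x0).
Proof.
apply: (@sub_finite_set _ _ [set x0]) => // x /=.
by have [//|xx] := eqVneq x x0; rewrite /indicator_pt (negbTE xx) eqxx.
Qed.

Lemma indicator_pt_coupling_gt0 x0 :
  0 < rsum (coupling p (indicator_pt x0) (indicator_pt x0)).
Proof.
have fin0 := indicator_pt_support x0.
apply: (rsum_gt0 (x := x0) mu_gt0).
- by move=> x; exact: coupling_ge0.
- by have [] := admissible_finitely_supported mu E_sym E_lf p4 0 (fun=> 0) (fun=> 0) fin0 fin0.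
- by rewrite /coupling /indicator_pt eqxx normr1 powR1 expr1n mul1r.
Qed.

Lemma energy_indicator_pt Lam a x0 : zeros a x0 ->
  energy E mu p Lam a (indicator_pt x0) = energy E mu p 0 (fun=> 0) (indicator_pt x0).
Proof.
move=> ax0; apply/funext => x; rewrite /energy; congr (_ + _).
rewrite /potential /indicator_pt mul0r; case: eqVneq => [->|_].
  by rewrite ax0 mulr0.
by rewrite normr0 powR0 ?mulr0// gt_eqF.
Qed.

(* This bound sees neither Lam nor the potentials, which vanish at x0. *)
Definition test_bound x0 : R :=
  let K := rsum (coupling p (indicator_pt x0) (indicator_pt x0)) in
  K * expR (p / 2 *
    (action E mu p 0 (fun=> 0) (fun=> 0) (indicator_pt x0) (indicator_pt x0) / K)
    - 1).

Lemma test_bound_gt0 x0 : 0 < test_bound x0.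
Proof. by rewrite mulr_gt0 ?expR_gt0// indicator_pt_coupling_gt0. Qed.

Lemma coupling_le_test_bound Lam a b u v x0 : 0 <= Lam ->
  (forall x, 0 <= a x) -> (forall x, 0 <= b x) ->
  admissible E mu p Lam a b u v -> ground_state E mu p a b Lam (u, v) ->
  zeros a x0 -> zeros b x0 -> rsum (coupling p u v) <= test_bound x0.
Proof.
move=> L0 a0 b0 adm gs ax0 bx0; have fin0 := indicator_pt_support x0.
have := ground_state_coupling_le E_sym E_lf mu_gt0 p4 L0 a0 b0 adm gs fin0 fin0
  (indicator_pt_coupling_gt0 x0).
by rewrite /test_bound /action !energy_indicator_pt.
Qed.

(** The upper bound comes from absorbing the logarithm. For the lower one, [mumin <= N] enters on
    the left of the inequality of [Nehari_energy_le] and [N <= C1] inside its logarithm. *)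
Lemma ground_state_energy_bounds Lam a b u v x0 : 0 <= Lam ->
  (forall x, 0 <= a x) -> (forall x, 0 <= b x) ->
  admissible E mu p Lam a b u v -> ground_state E mu p a b Lam (u, v) ->
  zeros a x0 -> zeros b x0 ->
  let C1 := energy_bound (test_bound x0) in
  rsum (energy E mu p Lam a u) + rsum (energy E mu p Lam b v) <= C1 /\
  p * mumin / (2 * (ln (C1 / mumin) + 1)) <= rsum (coupling p u v).
Proof.
move=> L0 a0 b0 adm gs ax0 bx0 C1.
have [N0 _] := gs; have [L1a L1b L1k _] := adm.
set N := rsum _ + rsum _; set K := rsum (coupling p u v).
have Npos : 0 < N by exact: Nehari_energy_gt0 adm N0.
have NK : N <= 2 / p * (ln (N / mumin) + 1) * K by exact: Nehari_energy_le adm N0 _.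
have K0 : 0 <= K by apply: rsum_ge0 => // x; exact: coupling_ge0.
have KD : K <= test_bound x0 by exact: coupling_le_test_bound gs ax0 bx0.
have NC : N <= C1 by exact: le_energy_bound Npos K0 KD (test_bound_gt0 x0) NK.
have K2N : K <= 2 * N.
  have L1ab := L1D L1a L1b.
  rewrite /N -rsumD// -rsumZ// le_rsum//; first exact: L1Z.
  by move=> x; exact: coupling_le_energy.
have mN : mumin <= N by exact: energy_ge_mumin Npos K0 K2N NK.
split=> //.
have lnNC : ln (N / mumin) <= ln (C1 / mumin).
  have C10 : 0 < C1 by exact: lt_le_trans NC.
  rewrite ler_ln ?posrE ?divr_gt0//.
  by rewrite ler_wpM2r ?invr_ge0 ?(ltW mumin_gt0).
have l1 : 0 < ln (C1 / mumin) + 1.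
  rewrite ltr_wpDl// (le_trans _ lnNC)// ln_ge0//.
  by rewrite ler_pdivlMr// mul1r.
rewrite ler_pdivrMr ?mulr_gt0//.
have {}NK : mumin <= 2 / p * (ln (C1 / mumin) + 1) * K.
  apply: (le_trans mN); apply: (le_trans NK).
  by rewrite ler_wpM2r// ler_wpM2l ?lerD2r// divr_ge0// ltW.
have -> : K * (2 * (ln (C1 / mumin) + 1)) = p * (2 / p * (ln (C1 / mumin) + 1) * K).
  by field; rewrite gt_eqF.
by rewrite ler_pM2l.
Qed.

(** * Comparison with the soft thresholding *)

Lemma energy_soft_threshold Lam a u (e : R) x : 0 <= Lam ->
  (forall x, 0 <= a x) -> 0 <= e -> (a x != 0 -> `|u x| <= e) ->
  Lam * a x * `|u x| `^ p <=
  energy E mu p Lam a u x - energy E mu p Lam a (soft_threshold e \o u) x.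
Proof.
move=> L0 a0 e0 ue; rewrite lerBrDr /energy addrCA lerD//.
  rewrite ge0_ler_powR ?nnegrE ?gradn_ge0 ?(ltW p_gt0)//.
  by apply: gradn_le => // y z; exact: soft_threshold_lipschitz.
(* On the zeros of a the potential is 1 and thresholding only lowers the power. Elsewhere the
   thresholded function vanishes, so the whole potential term is gained. *)
have [ax|/ue ux] := eqVneq (a x) 0.
  rewrite /potential ax !mulr0 mul0r add0r addr0 !mul1r.
  by rewrite ge0_ler_powR ?nnegrE ?soft_threshold_le// ltW.
rewrite /= soft_threshold0// normr0 powR0 ?gt_eqF// mulr0 addr0.
by rewrite /potential ler_wpM2r ?powR_ge0// lerDr.
Qed.

Lemma soft_threshold_support a u (e : R) : finite_set (zeros a) ->
  (forall x, a x != 0 -> `|u x| <= e) -> finitely_supported (soft_threshold e \o u).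
Proof.
move=> fina ue; apply: sub_finite_set fina => x /=.
by apply: contraNP => /eqP /ue ux; rewrite soft_threshold0.
Qed.

Lemma coupling_soft_threshold u v (e : R) x : 0 <= e ->
  coupling p (soft_threshold e \o u) (soft_threshold e \o v) x <= coupling p u v x.
Proof.
move=> e0; have p2 : 0 <= p - 2.
  by rewrite subr_ge0 (le_trans _ (ltW p4))// ler_nat.
have H (s t : R) : `|soft_threshold e s| `^ (p - 2) * soft_threshold e t ^+ 2 <=
    `|s| `^ (p - 2) * t ^+ 2.
  rewrite ler_pM ?powR_ge0 ?sqr_ge0//.
    by rewrite ge0_ler_powR ?nnegrE ?soft_threshold_le.
  rewrite -[leLHS]real_normK ?num_real// -[leRHS]real_normK ?num_real//.
  by rewrite lerXn2r ?nnegrE ?soft_threshold_le.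
by rewrite lerD//; exact: H.
Qed.

Lemma coupling_soft_threshold_sub u v (e : R) x : 0 <= e ->
  coupling p u v x - coupling p (soft_threshold e \o u) (soft_threshold e \o v) x
  <= 4 * p * e * (`|u x| `^ (p - 1) + `|v x| `^ (p - 1)).
Proof.
move=> e0.
have H (s t : R) : `|s| `^ (p - 2) * t ^+ 2 -
    `|soft_threshold e s| `^ (p - 2) * soft_threshold e t ^+ 2 <=
    2 * p * e * (`|s| `^ (p - 1) + `|t| `^ (p - 1)).
  rewrite -[t ^+ 2]real_normK ?num_real//.
  rewrite -[soft_threshold e t ^+ 2]real_normK ?num_real//.
  by apply: powR_sqr_sub_le; rewrite ?soft_threshold_le ?soft_threshold_ge.
have := H (u x) (v x); have := H (v x) (u x); rewrite /coupling /=.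
set z1 := _ `^ (p - 1); set z2 := _ `^ (p - 1); lra.
Qed.

(** [mul_xlnx_sub_le] applies with [|s|^(p-2)] as outer factor. Only an upper bound on the logarithm
    enters, so its singularity at 0 is harmless. *)
Lemma log_term_soft_threshold_sub u v (e L : R) x : 0 <= e -> 0 <= L ->
  ln (u x ^+ 2) <= L -> ln (v x ^+ 2) <= L ->
  log_term p u v x - log_term p (soft_threshold e \o u) (soft_threshold e \o v) x
  <= (L + 1) * (coupling p u v x -
      coupling p (soft_threshold e \o u) (soft_threshold e \o v) x).
Proof.
move=> e0 L0 uL vL; have p2 : 0 <= p - 2.
  by rewrite subr_ge0 (le_trans _ (ltW p4))// ler_nat.
have H (s t : R) : ln (t ^+ 2) <= L -> `|s| `^ (p - 2) * (t ^+ 2 * ln (t ^+ 2)) -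
    `|soft_threshold e s| `^ (p - 2) *
      (soft_threshold e t ^+ 2 * ln (soft_threshold e t ^+ 2)) <=
    (L + 1) * (`|s| `^ (p - 2) * t ^+ 2 -
      `|soft_threshold e s| `^ (p - 2) * soft_threshold e t ^+ 2).
  move=> tL; apply: mul_xlnx_sub_le; rewrite ?powR_ge0 ?sqr_ge0//.
    by rewrite ge0_ler_powR ?nnegrE ?soft_threshold_le.
  rewrite -[leLHS]real_normK ?num_real// -[leRHS]real_normK ?num_real//.
  by rewrite lerXn2r ?nnegrE ?soft_threshold_le.
have := H (u x) (v x) vL; have := H (v x) (u x) uL; rewrite /coupling /log_term /=.
lra.
Qed.

(** The Nehari identity minus the minimality inequality for the competitor gives [N - N' <= (I - I')
    + q (K - K') <= (L + 2) (K - K')]; here q stands for [2 / p]. *)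
Let drop_arith (Na Nb Na' Nb' I I' K K' q L : R) : Na + Nb - I = q * K ->
  q * K' <= Na' + Nb' - I' -> I - I' <= (L + 1) * (K - K') ->
  (L + 2) * (K - K') <= 1 -> q * (K - K') <= K - K' ->
  Na - Na' + (Nb - Nb') <= 1.
Proof. lra. Qed.

(* Thresholding does not increase the gradient term, so by minimality the
   potential energy off the zero sets is paid for by the loss K - K' of the
   coupling, which is O(e). *)
Lemma ground_state_energy_drop Lam a b u v (M C1 e : R) : 1 <= Lam ->
  (forall x, 0 <= a x) -> (forall x, 0 <= b x) -> 0 < M ->
  L1 (tail_weight p a M) -> L1 (tail_weight p b M) ->
  finite_set (zeros a) -> finite_set (zeros b) ->
  admissible E mu p Lam a b u v -> ground_state E mu p a b Lam (u, v) ->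
  rsum (energy E mu p Lam a u) + rsum (energy E mu p Lam b v) <= C1 -> mumin <= C1 ->
  0 <= e -> (forall x, a x != 0 -> `|u x| <= e) ->
  (forall x, b x != 0 -> `|v x| <= e) ->
  let d := 4 * p * e *
    (rsum (tail_weight p a M) + rsum (tail_weight p b M) + C1) in
  d < rsum (coupling p u v) -> (2 / p * ln (C1 / mumin) + 2) * d <= 1 ->
  (rsum (energy E mu p Lam a u) - rsum (energy E mu p Lam a (soft_threshold e \o u))) +
  (rsum (energy E mu p Lam b v) - rsum (energy E mu p Lam b (soft_threshold e \o v))) <= 1.
Proof.
move=> Lam1 a0 b0 M0 L1ta L1tb fina finb adm gs NC mC e0 ue ve d dK Ld.
have L0 : 0 <= Lam by exact: le_trans Lam1.
have [NN _] := gs; have [L1a L1b L1k L1l] := adm.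
set u' := soft_threshold e \o u; set v' := soft_threshold e \o v.
have finu' : finitely_supported u' by exact: soft_threshold_support fina ue.
have finv' : finitely_supported v' by exact: soft_threshold_support finb ve.
have [L1a' L1b' L1k' L1l'] :=
  admissible_finitely_supported mu E_sym E_lf p4 Lam a b finu' finv'.
have Na0 c w : (forall x, 0 <= c x) -> 0 <= rsum (energy E mu p Lam c w).
  by move=> c0; apply: rsum_ge0 => // x; exact: energy_ge0.
set L := 2 / p * ln (C1 / mumin).
have Cm : 1 <= C1 / mumin by rewrite ler_pdivlMr// mul1r.
have Lge0 : 0 <= L by rewrite mulr_ge0 ?ln_ge0// divr_ge0// ltW.
have uL x : ln (u x ^+ 2) <= L.
  apply: ln_sqr_le => //; apply: (le_trans (powR_mumin_le x L0 a0 L1a)).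
  rewrite ler_wpM2r ?invr_ge0 ?(ltW mumin_gt0)// (le_trans _ NC)//.
  by rewrite lerDl Na0.
have vL x : ln (v x ^+ 2) <= L.
  apply: ln_sqr_le => //; apply: (le_trans (powR_mumin_le x L0 b0 L1b)).
  rewrite ler_wpM2r ?invr_ge0 ?(ltW mumin_gt0)// (le_trans _ NC)//.
  by rewrite lerDr Na0.
set K := rsum (coupling p u v) in dK *; set K' := rsum (coupling p u' v').
have KKd : K - K' <= d.
  have L1u := L1_powRB1 p4 Lam1 a0 M0 L1ta L1a.
  have L1v := L1_powRB1 p4 Lam1 b0 M0 L1tb L1b.
  have pe0 : 0 <= 4 * p * e by rewrite !mulr_ge0// ltW.
  apply: (@le_trans _ _ (4 * p * e * (rsum (fun x => `|u x| `^ (p - 1)) +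
    rsum (fun x => `|v x| `^ (p - 1))))); last first.
    rewrite ler_wpM2l//.
    apply: (le_trans (lerD (rsum_powRB1_le mu_gt0 p4 Lam1 a0 M0 L1ta L1a)
      (rsum_powRB1_le mu_gt0 p4 Lam1 b0 M0 L1tb L1b))).
    by rewrite addrACA lerD2l.
  have L1uv := L1D L1u L1v.
  rewrite -(rsumD mu_gt0 L1u L1v) -(rsumZ mu_gt0 _ L1uv) -(rsumB mu_gt0 L1k L1k').
  apply: (le_rsum mu_gt0 (L1B L1k L1k') (L1Z _ L1uv)) => x.
  exact: coupling_soft_threshold_sub.
have KK' : K' <= K.
  by apply: le_rsum => // x; exact: coupling_soft_threshold.
(* Since [d < K], thresholding cannot destroy the coupling, so the ray through the competitor meets
   the Nehari manifold. *)
have K'0 : 0 < K'.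
  by rewrite -subr_gt0 in dK; apply: lt_le_trans dK _; rewrite lerBlDr -lerBlDl.
have II : rsum (log_term p u v) - rsum (log_term p u' v') <= (L + 1) * (K - K').
  have L1kk := L1B L1k L1k'.
  rewrite -(rsumB mu_gt0 L1k L1k') -(rsumZ mu_gt0 _ L1kk) -(rsumB mu_gt0 L1l L1l').
  apply: (le_rsum mu_gt0 (L1B L1l L1l') (L1Z _ L1kk)) => x.
  exact: log_term_soft_threshold_sub.
(* From [K' <= K <= K' exp(...)] the exponent is non-negative: the competitor has to be scaled up,
   not down, to reach the Nehari manifold. *)
have A'K' : 2 / p * K' <= action E mu p Lam a b u' v'.
  have := ground_state_coupling_le E_sym E_lf mu_gt0 p4 L0 a0 b0 adm gs
    finu' finv' K'0.
  rewrite -/K -/K' => /(le_trans KK'); rewrite -{1}[K']mulr1 ler_pM2l//.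
  rewrite -[leLHS](expR0 R) ler_expR subr_ge0 mulrA ler_pdivlMr// mul1r => h.
  rewrite -(@ler_pM2l _ (p / 2)) ?divr_gt0// (le_trans _ h)//.
  by rewrite mulrA [p / 2 * _](_ : _ = 1) ?mul1r//; field; rewrite gt_eqF.
have := Nehari_action E_lf mu_gt0 p4 L0 a0 b0 adm NN.
rewrite -/K; move: A'K'; rewrite /action => A'K' AK.
have KKL : (L + 2) * (K - K') <= 1.
  by apply: le_trans Ld; rewrite ler_wpM2l// addr_ge0.
have p21 : 2 / p * (K - K') <= K - K'.
  rewrite ler_piMl ?subr_ge0// ler_pdivrMr// mul1r ltW//.
  by rewrite (lt_trans _ p4)// ltr_nat.
exact: drop_arith AK A'K' II KKL p21.
Qed.
End Estimates.

(** * Choice of the constants and conclusion *)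

Theorem theorem1p7 (R : realType) (V : choiceType) (E : rel V) (mu : V -> R)
    (mumin p a0 b0 : R)
    (hG : connected_locally_finite_graph E)
    (hmumin : 0 < mumin) (hmu : forall x, mumin <= mu x)
    (hp : 4 < p) (ha0 : 0 < a0) (hb0 : 0 < b0) :
  exists C : R, 0 < C /\
  forall a b : V -> R,
    (forall x, 0 <= a x) -> (forall x, 0 <= b x) ->
    zeros a !=set0 -> bounded_domain E (zeros a) ->
    zeros b !=set0 -> bounded_domain E (zeros b) ->
    zeros a `&` zeros b !=set0 -> bounded_domain E (zeros a `&` zeros b) ->
    A2'' mu a b ->
    (forall x, (~` zeros a) x -> a0 <= a x) ->
    (forall x, (~` zeros b) x -> b0 <= b x) ->
  exists Lam0 : R, 0 < Lam0 /\
  forall Lam : R, Lam0 <= Lam ->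
  forall u v : V -> R, ground_state E mu p a b Lam (u, v) ->
    (gint mu (~` zeros a) (fun x => (`|u x| `^ p)%R) <= (C * Lam^-1)%:E)%E /\
    (gint mu (~` zeros b) (fun x => (`|v x| `^ p)%R) <= (C * Lam^-1)%:E)%E.
Proof.
have [Esym Elf _] := hG.
have mu0 x : 0 < mu x by exact: lt_le_trans (hmu x).
have p0 : 0 < p by exact: lt_trans hp.
(* The energy drop will be at most 1, and it dominates [Lam * a0], respectively [Lam * b0], times
   the integral; the sum of the inverses serves both. *)
exists (a0^-1 + b0^-1); split; first by rewrite addr_gt0 ?invr_gt0.
move=> a b age0 bge0 _ _ _ _ [x0 [ax0 bx0]] _ [M [M0 vola volb taila tailb]] aa0 bb0.
have sub_fin c : (volume mu (sublevel c M) < +oo)%E -> finite_set (zeros c).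
  move/(finite_volume_finite hmumin hmu); apply: sub_finite_set => x.
  by rewrite /zeros/sublevel/= => ->; exact: ltW.
have L1ta := L1_tail_weight p mu0 age0 M0 vola taila.
have L1tb := L1_tail_weight p mu0 bge0 M0 volb tailb.
set C1 := energy_bound mumin p (test_bound E mu p x0).
have D0 : 0 < test_bound E mu p x0 by exact: test_bound_gt0 hmumin hmu _ _.
have mC : mumin <= C1.
  rewrite /C1 /energy_bound lerDr mulr_ge0//.
  by apply: divr_ge0; [apply: mulr_ge0 => //|]; exact: ltW.
have C10 : 0 < C1 by exact: lt_le_trans mC.
have lC : 0 <= ln (C1 / mumin) by rewrite ln_ge0// ler_pdivlMr// mul1r.
set k1 := p * mumin / (2 * (ln (C1 / mumin) + 1)).
have k10 : 0 < k1 by rewrite divr_gt0 ?mulr_gt0// ltr_wpDl.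
set H := rsum mu (tail_weight p a M) + rsum mu (tail_weight p b M) + C1.
have H0 : 0 < H.
  by rewrite ltr_wpDl// addr_ge0// rsum_ge0// => x; exact: tail_weight_ge0.
set L2 := 2 / p * ln (C1 / mumin) + 2.
have L20 : 0 < L2 by rewrite ltr_wpDl// mulr_ge0// divr_ge0// ltW.
(* The value d of [ground_state_energy_drop] will be r: [r <= k1 / 2] puts it strictly below K, and
   [r <= L2^-1] bounds the total drop by 1. *)
set r := Num.min (k1 / 2) L2^-1.
have r0 : 0 < r by rewrite lt_min divr_gt0// invr_gt0.
set e := r / (4 * p * H).
have e0 : 0 < e by rewrite divr_gt0// !mulr_gt0.
have eH : 4 * p * e * H = r by rewrite /e; field; rewrite !gt_eqF.
set c0 := Num.min a0 b0; have c00 : 0 < c0 by rewrite lt_min ha0.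
(* The bound 1 serves the estimates of the powers [p - 1]; the other forces
   [C1 / (Lam * c0 * mumin) <= e^p], hence values at most e off the zeros. *)
exists (Num.max 1 (C1 / (c0 * mumin * e `^ p))).
split=> [|Lam]; first by rewrite lt_max ltr01.
rewrite ge_max => /andP[Lam1 Lamc] u v gs.
have Lam0 : 0 < Lam by exact: lt_le_trans Lam1.
have [[Hu Hv _ _] _] := gs.
have adm : admissible E mu p Lam a b u v.
  by have := admissible_Hspace Esym Elf hmumin hmu hp Lam1 age0 bge0 M0 L1ta L1tb Hu Hv.
have [L1a L1b _ _] := adm.
have [NC Kk1] := ground_state_energy_bounds Esym Elf hmumin hmu hp (ltW Lam0)
  age0 bge0 adm gs ax0 bx0.
have Na0 (c w : V -> R) : (forall x, 0 <= c x) -> 0 <= rsum mu (energy E mu p Lam c w).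
  by move=> cge0; apply: rsum_ge0 => // x; exact: energy_ge0 (ltW Lam0) cge0.
have small (c : V -> R) (d : R) (w : V -> R) x : (forall x, 0 <= c x) ->
    L1 mu setT (energy E mu p Lam c w) -> rsum mu (energy E mu p Lam c w) <= C1 ->
    c0 <= d -> ((~` zeros c) x -> d <= c x) -> c x != 0 -> `|w x| <= e.
  move=> cge0 L1c NcC c0d dc cx0; rewrite leNgt; apply/negP => ew.
  have := gt0_ltr_powR p0 _ _ ew; rewrite !nnegrE (ltW e0) normr_ge0.
  move=> /(_ isT isT); apply/negP; rewrite -leNgt/=.
  have c0c : c0 <= c x by apply: (le_trans c0d); apply: dc; exact/eqP.
  have := powR_potential_le hmumin hmu Lam0 cge0 c00 c0c L1c.
  move=> /le_trans; apply.
  rewrite ler_pdivrMr ?mulr_gt0// (le_trans NcC)//.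
  move: Lamc; rewrite ler_pdivrMr ?mulr_gt0 ?powR_gt0//.
  by move/le_trans; apply; rewrite le_eqVlt; apply/orP; left; apply/eqP; ring.
have ue x : a x != 0 -> `|u x| <= e.
  apply: (small a a0) => //; [|by rewrite ge_min lexx|exact: aa0].
  by apply: le_trans NC; rewrite lerDl Na0.
have ve x : b x != 0 -> `|v x| <= e.
  apply: (small b b0) => //; [|by rewrite ge_min lexx orbT|exact: bb0].
  by apply: le_trans NC; rewrite lerDr Na0.
have drop1 : (rsum mu (energy E mu p Lam a u) -
      rsum mu (energy E mu p Lam a (soft_threshold e \o u))) +
    (rsum mu (energy E mu p Lam b v) -
      rsum mu (energy E mu p Lam b (soft_threshold e \o v))) <= 1.
  apply: (ground_state_energy_drop Esym Elf hmumin hmu hp Lam1 age0 bge0 M0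
    L1ta L1tb (sub_fin _ vola) (sub_fin _ volb) adm gs NC mC (ltW e0) ue ve).
  - rewrite -/H eH; apply: (@le_lt_trans _ _ (k1 / 2)); first by rewrite ge_min lexx.
    by apply: lt_le_trans Kk1; rewrite ltr_pdivrMr// ltr_pMr// ltr1n.
  - by rewrite -/H eH -/L2 mulrC -ler_pdivlMr// mul1r ge_min lexx orbT.
have L1soft (c w : V -> R) : finite_set (zeros c) -> (forall x, c x != 0 -> `|w x| <= e) ->
    L1 mu setT (energy E mu p Lam c (soft_threshold e \o w)).
  move=> finc we; have finw := soft_threshold_support finc we.
  by have [] := admissible_finitely_supported mu Esym Elf hp Lam c c finw finw.
(* Off the zeros [Lam * d * |w|^p] is at most the pointwise energy drop, which is non-negative
   everywhere and so may be summed over all of V. *)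
have tail (c : V -> R) (d : R) (w : V -> R) : (forall x, 0 <= c x) -> 0 < d ->
    (forall x, (~` zeros c) x -> d <= c x) -> finite_set (zeros c) ->
    (forall x, c x != 0 -> `|w x| <= e) -> L1 mu setT (energy E mu p Lam c w) ->
    0 <= rsum mu (energy E mu p Lam c w) -
      rsum mu (energy E mu p Lam c (soft_threshold e \o w)) /\
    (gint mu (~` zeros c) (fun x => (`|w x| `^ p)%R) <= ((Lam * d)^-1 *
      (rsum mu (energy E mu p Lam c w) -
       rsum mu (energy E mu p Lam c (soft_threshold e \o w))))%:E)%E.
  move=> cge0 d0 dc finc we L1w; have L1w' := L1soft _ _ finc we.
  have L1d := L1B L1w L1w'.
  have drop x := energy_soft_threshold Elf hmumin hmu hp (ltW Lam0) cge0 (ltW e0) (@we x).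
  have drop0 x : 0 <= energy E mu p Lam c w x -
      energy E mu p Lam c (soft_threshold e \o w) x.
    by apply: le_trans (drop x); rewrite mulr_ge0 ?powR_ge0// mulr_ge0// ltW.
  rewrite -(rsumB mu0 L1w L1w'); split; first exact: rsum_ge0.
  rewrite -(rsumZ mu0 _ L1d); apply: rsum_le_subset => //.
  - by move=> x; rewrite mulr_ge0// invr_ge0 mulr_ge0 ?ltW.
  - exact: L1Z.
  - move=> x cx; rewrite ler_pdivlMl ?mulr_gt0//; apply: le_trans (drop x).
    by rewrite ler_wpM2r ?powR_ge0// ler_wpM2l ?(ltW Lam0)// dc.
have [Da Ia] := tail a a0 u age0 ha0 aa0 (sub_fin _ vola) ue L1a.
have [Db Ib] := tail b b0 v bge0 hb0 bb0 (sub_fin _ volb) ve L1b.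
have scale (d X : R) : 0 < d -> X <= 1 -> d^-1 <= a0^-1 + b0^-1 ->
    (Lam * d)^-1 * X <= (a0^-1 + b0^-1) * Lam^-1.
  move=> d0 X1 dC; apply: (@le_trans _ _ (d^-1 * Lam^-1)).
    by rewrite -invfM mulrC [d * _]mulrC ler_piMl// invr_ge0 mulr_ge0// ltW.
  by rewrite ler_wpM2r// invr_ge0 ltW.
(* Both drops are non-negative, so their joint bound 1 holds for each. *)
have le1 (X Y : R) : 0 <= X -> 0 <= Y -> X + Y <= 1 -> X <= 1 /\ Y <= 1.
  by move=> X0 Y0 XY; split; apply: le_trans XY; rewrite (lerDl, lerDr).
have [Ua Ub] := le1 _ _ Da Db drop1.
split.
- by apply: (le_trans Ia); rewrite lee_fin scale// lerDl invr_ge0 ltW.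
- by apply: (le_trans Ib); rewrite lee_fin scale// lerDr invr_ge0 ltW.
Qed.
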